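(* Let $A_1,\ldots,A_m$ be non-negative matrices that define operators on $l^2(R)$ and let $t\in[1,m]$. If we denote $S_i=A_iA_i^T$ and $$T_i=S_i^{(t)}S_{i+1}^{(t)}\cdots S_m^{(t)}S_1^{(t)}S_2^{(t)}\cdots S_{i-1}^{(t)}$$ for $i=1,\ldots,m$, then $$\|A_1\circ A_2\circ\cdots\circ A_m\|^2\le\rho(S_1\circ S_2\circ\cdots\circ S_m)\le\rho\left(T_1^{(\frac1t)}\circ\cdots\circ T_m^{(\frac1t)}\right)^{\frac1m}$$ $$\le\rho(S_1^{(t)}\cdots S_m^{(t)})^{\frac1t}\le\rho((S_1\cdots S_m)^{(t)})^{\frac1t}\le\rho(S_1\cdots S_m).$$
   Context: $R$ is either $\{1,\ldots,n\}$ for some $n\in\mathbb{N}$ or $\mathbb{N}$, and $l^2(R)$ is the complex Hilbert space of square-summable sequences indexed by $R$ with the usual norm. A matrix $A=[a_{ij}]_{i,j\in R}$ (possibly infinite) is non-negative if $a_{ij}\ge0$ for all $i,j\in R$. A non-negative matrix $A$ defines an operator on $l^2(R)$ if $Ax\in l^2(R)$ for all $x\in l^2(R)$, where $(Ax)_i=\sum_{j\in R}a_{ij}x_j$; this operator is automatically bounded, and $A$ is identified with it. $\|A\|$ is the operator norm, $\rho(A)$ the spectral radius, $A^T=[a_{ji}]$ the transpose (which defines the adjoint operator); juxtaposition is the ordinary matrix product. For non-negative matrices, $A\circ B=[a_{ij}b_{ij}]_{i,j\in R}$ is the Hadamard product and $A^{(t)}=[a_{ij}^t]_{i,j\in R}$,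 $t\ge0$, is the Hadamard power (with $0^0=1$). All matrices occurring in the claim as arguments of $\rho$ or $\|\cdot\|$ define operators on $l^2(R)$. *)

(* Defs.v *)
From HB Require Import structures.
From mathcomp Require Import all_boot all_order all_algebra.
From mathcomp Require Import all_classical all_reals.
From mathcomp Require Import ereal esum exp.
From mathcomp Require Import complex.

Set Implicit Arguments.
Unset Strict Implicit.
Unset Printing Implicit Defensive.

Import Order.TTheory GRing.Theory Num.Theory.
Import Normc.

Local Open Scope classical_set_scope.
Local Open Scope ring_scope.
Local Open Scope complex_scope.

Definition index_range (D : set nat) : Prop :=
  D = [set k | (1 <= k)%N] \/
  exists2 n, (1 <= n)%N & D = [set k | (1 <= k <= n)%N].

(* Everything below depends on the index type I only through its elements; the
   theorem takes for I the subtype of nat given by a set D in index_range. *)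

Section Sums.
Variables (K : realType) (I : choiceType).
Implicit Types (f : I -> K) (x : I -> K[i]).

(* Sum of an absolutely convergent family: positive part minus negative part,
   as \esum is meant for non-negative terms only. *)
Definition rsum f : K :=
  fine (\esum_(i in [set: I]) (Num.max (f i) 0)%:E) -
  fine (\esum_(i in [set: I]) (Num.max (- f i) 0)%:E).

Definition csum x : K[i] :=
  rsum (fun i => complex.Re (x i)) +i* rsum (fun i => complex.Im (x i)).

Definition csummable x : Prop := summable [set: I] (fun i => (normc (x i))%:E).

Definition l2 x : Prop := summable [set: I] (fun i => (normc (x i) ^+ 2)%:E).

Definition l2norm x : K :=
  Num.sqrt (fine (\esum_(i in [set: I]) (normc (x i) ^+ 2)%:E)).

End Sums.

Section Matrices.
Variables (K : realType) (I : choiceType).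

Definition imatrix : Type := I -> I -> K.

Implicit Types (A B : imatrix) (x y : I -> K[i]) (T : (I -> K[i]) -> I -> K[i]).

Definition nonneg A : Prop := forall i j, 0 <= A i j.

Definition mxact A x : I -> K[i] := fun i => csum (fun j => (A i j)%:C * x j).

(* For x in l2 and A non-negative, replacing x by its modulus shows that
   convergence of all these series is the same as absolute convergence. *)
Definition defines_operator A : Prop :=
  forall x, l2 x ->
    (forall i, csummable (fun j => (A i j)%:C * x j)) /\ l2 (mxact A x).

Definition opnorm A : K :=
  sup [set l2norm (mxact A x) | x in [set x | l2 x /\ l2norm x <= 1]].

Definition bounded_operator T : Prop :=
  [/\ forall x, l2 x -> l2 (T x),
      forall (a : K[i]) x y, l2 x -> l2 y ->
        T (fun i => a * x i + y i) = (fun i => a * T x i + T y i)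
    & exists M : K, forall x, l2 x -> l2norm (T x) <= M * l2norm x].

Definition shift_op (z : K[i]) A x : I -> K[i] := fun i => z * x i - mxact A x i.

Definition resolvent_set A : set K[i] :=
  [set z | exists2 T, bounded_operator T &
     forall x, l2 x -> T (shift_op z A x) = x /\ shift_op z A (T x) = x].

Definition spectrum A : set K[i] := ~` resolvent_set A.

Definition spectral_radius A : K := sup [set normc z | z in spectrum A].

Definition mxid : imatrix := fun i j => (i == j)%:R.

Definition mxtr A : imatrix := fun i j => A j i.

Definition mxprod A B : imatrix := fun i j => rsum (fun k => A i k * B k j).

(* The ordered product of the matrices of s, taken from left to right. *)
Definition mxprod_seq (s : seq imatrix) : imatrix := foldr mxprod mxid s.

Definition hadamard (m : nat) (A : 'I_m -> imatrix) : imatrix :=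
  fun i j => \prod_(k < m) A k i j.

(* powR satisfies 0 `^ 0 = 1. *)
Definition hpow A (t : K) : imatrix := fun i j => A i j `^ t.

End Matrices.

(* Main.v *)
(* Write [S_i = A_i A_i^T] and let [r(A)] be the infimum of the [lam] with
   [||A^n|| <= C lam^n].  A Neumann series shows that the spectrum lies in the
   disc of radius [r(A)].  For non-negative [A], if [r = r(A) > 0] were not in the
   spectrum, the non-negative resolvents at [lam > r] would stay bounded as [lam]
   decreases to [r], hence could be continued to a non-negative resolvent at some
   [mu < r], which dominates every [A^n / mu^(n+1)] and forces [r <= mu].  So the
   spectral radius equals [r(A)] and every comparison below reduces to entrywise
   inequalities between non-negative matrices.

   These all come from one inequality: for [0 <= u_l <= 1] and [m al >= 1],
   [prod_l u_l^al <= (1/m) sum_l u_l].  After normalisation it gives the Hoelder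
   inequality with total exponent [m al >= 1], that is
   [prod_l B_l^(al) * prod_l C_l^(al) <= prod_l (B_l C_l)^(al)] (Hadamard products
   and powers), and [||prod_l B_l^(al)|| <= prod_l ||B_l||^al].  It is used with
   [al = 1] for [(A_1 o ... o A_m)(A_1 o ... o A_m)^T <= S_1 o ... o S_m], with
   [al = 1/t] for [(S_1 o ... o S_m)^m <= T_1^(1/t) o ... o T_m^(1/t)] and for
   [r(T_1^(1/t) o ... o T_m^(1/t)) <= prod_i r(T_i)^(1/t)], and with one factor and
   [al = t] for the last two bounds.  All [T_i] have the spectral radius of [T_1],
   being cyclic rotations of the same product. *)
Require Import Defs.
From HB Require Import structures.
From mathcomp Require Import all_boot all_order all_algebra.
From mathcomp Require Import finmap.
From mathcomp Require Import all_classical all_reals.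
From mathcomp Require Import ereal esum exp.
From mathcomp Require Import complex.
From mathcomp Require Import ring lra zify.

Set Implicit Arguments.
Unset Strict Implicit.
Unset Printing Implicit Defensive.

Import Order.TTheory GRing.Theory Num.Theory.

Local Open Scope classical_set_scope.
Local Open Scope ring_scope.

Local Notation esumT f := (esum [set: _] f).

(** * Unordered sums *)

Section EsumLemmas.
Variable K : realType.
Local Open Scope ereal_scope.

Lemma esum_swap (I J : choiceType) (a : I -> J -> \bar K) :
  (forall i j, 0 <= a i j) ->
  esumT (fun i => esumT (a i)) = esumT (fun j => esumT (a ^~ j)).
Proof.
move=> a0.
rewrite (@esum_esum _ _ _ setT (fun=> setT) a)//.
rewrite (@esum_esum _ _ _ setT (fun=> setT) (fun j i => a i j))//.
apply: (reindex_esum _ _ (fun k : J * I => (k.2, k.1))).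
split => //=; first by move=> [i j] [j' i'] _ _ /= [-> ->].
by move=> [i j] _; exists (j, i).
Qed.

Variable I : choiceType.
Implicit Types f g : I -> \bar K.

(** An unordered sum of non-negative terms is the supremum of its finite partial sums; estimates
    below are checked on finite index sets through this bound. *)
Lemma esumT_le f (M : \bar K) :
  (forall F : {fset I}, \sum_(i <- F) f i <= M) -> esumT f <= M.
Proof.
move=> h; apply: ge_ereal_sup => _ [F [finF _] <-].
by rewrite fsbig_finite.
Qed.

Lemma ge_esum_fset f (F : {fset I}) : (forall i, 0 <= f i) ->
  \sum_(i <- F) f i <= esumT f.
Proof.
move=> f0; apply: esum_ge; exists [set` F]; first by split => //; exact: finite_fset.
by rewrite fsbig_finite//= set_fsetK.
Qed.

Lemma ge_esum1 f i : (forall i, 0 <= f i) -> f i <= esumT f.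
Proof.
by move=> f0; have := ge_esum_fset [fset i]%fset f0; rewrite big_seq_fset1.
Qed.

Lemma esum_only f i : (forall j, 0 <= f j) -> (forall j, j != i -> f j = 0) ->
  esumT f = f i.
Proof.
move=> f0 fi; rewrite -[RHS](@esum_set1 _ _ i f)// [RHS]esum_mkcond.
apply: eq_esum => j _; case: ifPn => // ji; apply: fi.
by apply: contra ji => /eqP ->; rewrite inE.
Qed.

Lemma esumZl (c : K) f : (0 <= c)%R -> (forall i, 0 <= f i) ->
  esumT (fun i => c%:E * f i) = c%:E * esumT f.
Proof.
have aux (d : K) g : (0 <= d)%R -> (forall i, 0 <= g i) ->
    esumT (fun i => d%:E * g i) <= d%:E * esumT g.
  move=> d0 g0; apply: esumT_le => F.
  rewrite -ge0_sume_distrr//; apply: lee_wpmul2l; first by rewrite lee_fin.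
  exact: ge_esum_fset.
rewrite le_eqVlt => /predU1P[<- f0|c0 f0].
  by rewrite mul0e esum1// => i _; rewrite mul0e.
apply/eqP; rewrite eq_le aux//=; last exact: ltW.
(* The reverse inequality is [aux] for the scalar c^-1 and the family c f. *)
rewrite -lee_pdivlMl//; apply: le_trans (aux _ _ _ _).
- apply: le_esum => i _; rewrite muleA -EFinM mulVf ?mul1e//; exact: lt0r_neq0.
- by rewrite invr_ge0 ltW.
- by move=> i; rewrite mule_ge0// lee_fin ltW.
Qed.

Lemma esum0 : esumT (fun _ : I => 0 : \bar K) = 0.
Proof. by rewrite esum1. Qed.

Lemma EFin_fine_le (x : \bar K) (M : K) : 0 <= x -> x <= M%:E -> (fine x)%:E = x.
Proof. by move=> x0 xM; rewrite fineK// ge0_fin_numE// (le_lt_trans xM)// ltry. Qed.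

Lemma fine_le_real (x : \bar K) (M : K) : 0 <= x -> x <= M%:E -> (fine x <= M)%R.
Proof. by move=> x0 xM; rewrite -lee_fin (EFin_fine_le x0 xM). Qed.

End EsumLemmas.

(** * Bounded non-negative matrices *)

Section BoundedMatrices.
Variables (K : realType) (I : choiceType).
Implicit Types (A B C : imatrix K I) (x y u v : I -> K) (a b c M N : K).

Definition vnonneg u := forall i, 0 <= u i.

Definition sqnorm u : \bar K := esumT (fun i => (u i ^+ 2)%:E).

Definition bilin A x y : \bar K :=
  esumT (fun i => esumT (fun j => (x i * A i j * y j)%:E)).

(* For non-negative A this says ||A|| <= M: taking moduli, non-negative test
   vectors suffice.  Unlike the operator norm it is linear in A. *)
Definition bounded_by A M :=
  forall x y, vnonneg x -> vnonneg y -> (sqnorm x <= 1)%E -> (sqnorm y <= 1)%E ->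
  (bilin A x y <= M%:E)%E.

Definition eact A y i : \bar K := esumT (fun j => (A i j * y j)%:E).

(** [fine] sends +oo to 0, so [ract] is the true value of (A y)_i only where the row sum is finite;
    [ractE] supplies this for square-summable y. *)
Definition ract A y i : K := fine (eact A y i).

Lemma sqnorm_ge0 u : (0 <= sqnorm u)%E.
Proof. by apply: esum_ge0 => i _; rewrite lee_fin sqr_ge0. Qed.

Lemma sqnormZ c u : sqnorm (fun i => c * u i) = ((c ^+ 2)%:E * sqnorm u)%E.
Proof.
rewrite /sqnorm -esumZl ?sqr_ge0//; last by move=> i; rewrite lee_fin sqr_ge0.
by apply: eq_esum => i _; rewrite exprMn.
Qed.

Lemma sqnorm_le u v : vnonneg u -> (forall i, u i <= v i) ->
  (sqnorm u <= sqnorm v)%E.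
Proof.
move=> u0 uv; apply: le_esum => i _; rewrite lee_fin ler_sqr ?nnegrE//.
exact: le_trans (uv i).
Qed.

Lemma sqnorm_le0 u i : (sqnorm u <= 0)%E -> u i = 0.
Proof.
move=> u0; apply/eqP; rewrite -sqrf_eq0 eq_le sqr_ge0 andbT -lee_fin.
apply: le_trans u0.
by apply: (@ge_esum1 _ _ (fun i => (u i ^+ 2)%:E)) => j; rewrite lee_fin sqr_ge0.
Qed.

Lemma sqnorm0 : sqnorm (fun=> 0) = 0%E.
Proof. by rewrite /sqnorm esum1// => i _; rewrite expr0n. Qed.

Lemma sqnormP u : (sqnorm u < +oo)%E ->
  exists2 a, 0 <= a & (sqnorm u <= (a ^+ 2)%:E)%E.
Proof.
move=> uoo; exists (Num.sqrt (fine (sqnorm u))); first exact: sqrtr_ge0.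
by rewrite sqr_sqrtr ?fine_ge0 ?sqnorm_ge0// fineK// ge0_fin_numE// sqnorm_ge0.
Qed.

Lemma sqnorm_lty u a : (sqnorm u <= a%:E)%E -> (sqnorm u < +oo)%E.
Proof. by move=> /le_lt_trans; apply; rewrite ltry. Qed.

Lemma bilinE A x y : nonneg A -> vnonneg x -> vnonneg y ->
  bilin A x y = esumT (fun i => ((x i)%:E * eact A y i)%E).
Proof.
move=> A0 x0 y0; apply: eq_esum => i _; rewrite /eact -esumZl//.
  by apply: eq_esum => j _; rewrite -EFinM mulrA.
by move=> j; rewrite lee_fin mulr_ge0.
Qed.

Lemma bilinZ A c a x y : nonneg A -> vnonneg x -> vnonneg y -> 0 <= c -> 0 <= a ->
  bilin A (fun i => c * x i) (fun i => a * y i) = ((c * a)%:E * bilin A x y)%E.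
Proof.
move=> A0 x0 y0 c0 a0; rewrite /bilin -esumZl ?mulr_ge0//; last first.
  by move=> i; apply: esum_ge0 => j _; rewrite lee_fin !mulr_ge0.
apply: eq_esum => i _; rewrite -esumZl ?mulr_ge0//; last first.
  by move=> j; rewrite lee_fin !mulr_ge0.
by apply: eq_esum => j _; rewrite -EFinM; congr _%:E; ring.
Qed.

Lemma bounded_by_ge0 A M : bounded_by A M -> 0 <= M.
Proof.
move=> AM; rewrite -lee_fin; have := AM (fun=> 0) (fun=> 0).
rewrite sqnorm0 /bilin esum1 ?esum1//; first by apply.
by move=> i _; rewrite esum1// => j _; rewrite !mulr0.
Qed.

(** Homogeneity: both vectors are rescaled to the unit ball. If a or b is 0, the corresponding
    vector vanishes and so does the form. *)
Lemma bilin_le A M a b x y : nonneg A -> bounded_by A M ->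
  vnonneg x -> vnonneg y -> 0 <= a -> 0 <= b ->
  (sqnorm x <= (a ^+ 2)%:E)%E -> (sqnorm y <= (b ^+ 2)%:E)%E ->
  (bilin A x y <= (M * a * b)%:E)%E.
Proof.
move=> A0 AM x0 y0; rewrite le_eqVlt => /predU1P[<- _|a0].
  rewrite expr0n mulr0 mul0r => xz _; rewrite /bilin esum1// => i _.
  by rewrite esum1// => j _; rewrite (sqnorm_le0 i xz) !mul0r.
rewrite le_eqVlt => /predU1P[<- _|b0 xa yb].
  rewrite expr0n mulr0 => yz; rewrite /bilin esum1// => i _.
  by rewrite esum1// => j _; rewrite (sqnorm_le0 j yz) !mulr0.
have scale c u : 0 < c -> vnonneg u -> (sqnorm u <= (c ^+ 2)%:E)%E ->
    vnonneg (fun i => c^-1 * u i) /\ (sqnorm (fun i => (c^-1 * u i)%R) <= 1)%E.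
  move=> c0 u0 uc; split; first by move=> i; rewrite mulr_ge0// invr_ge0 ltW.
  rewrite sqnormZ exprVn lee_pdivrMl ?exprn_gt0//.
  by rewrite mule1.
have [xs xs1] := scale _ _ a0 x0 xa; have [ys ys1] := scale _ _ b0 y0 yb.
have := AM _ _ xs ys xs1 ys1.
have [a0' b0'] : 0 <= a^-1 /\ 0 <= b^-1 by rewrite !invr_ge0 !ltW.
rewrite (bilinZ A0 x0 y0 a0' b0').
by rewrite -invfM lee_pdivrMl ?mulr_gt0// -EFinM mulrC mulrA.
Qed.

Lemma esum_fset_if (F : {fset I}) (f : I -> \bar K) : (forall i, 0 <= f i)%E ->
  esumT (fun i => if i \in F then f i else 0%E) = (\sum_(i <- F) f i)%E.
Proof.
move=> f0; rewrite -[F in RHS]set_fsetK -fsbig_finite; last exact: finite_fset.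
rewrite -(esum_fset (finite_fset F))//.
by rewrite [RHS]esum_mkcond; apply: eq_esum => i _; rewrite mem_setE.
Qed.

Lemma sqnorm_delta i : sqnorm (fun j => (j == i)%:R) = 1%E.
Proof.
rewrite /sqnorm (@esum_only _ _ _ i)/=; first by rewrite eqxx expr1n.
  by move=> j; rewrite lee_fin sqr_ge0.
by move=> j /negPf ->; rewrite expr0n.
Qed.

Lemma eact_ge0 A y i : nonneg A -> vnonneg y -> (0 <= eact A y i)%E.
Proof. by move=> A0 y0; apply: esum_ge0 => j _; rewrite lee_fin mulr_ge0. Qed.

Lemma ract_ge0 A y : nonneg A -> vnonneg y -> vnonneg (ract A y).
Proof. by move=> A0 y0 i; rewrite fine_ge0// eact_ge0. Qed.

(** A coordinate of A y is the form evaluated at the basis vector of index i on the left. In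
    particular every row sum is finite. *)
Lemma eact_le A M b y i : nonneg A -> bounded_by A M -> vnonneg y -> 0 <= b ->
  (sqnorm y <= (b ^+ 2)%:E)%E -> (eact A y i <= (M * b)%:E)%E.
Proof.
move=> A0 AM y0 b0 yb; have d0 : vnonneg (fun j => (j == i)%:R) by move=> j.
have := bilin_le A0 AM d0 y0 ler01 b0; rewrite expr1n mulr1 sqnorm_delta.
move=> /(_ (lexx _) yb); apply: le_trans; rewrite bilinE// (@esum_only _ _ _ i).
- by rewrite eqxx mul1e.
- by move=> j; rewrite mule_ge0 ?lee_fin// eact_ge0.
- by move=> j /negPf ->; rewrite mul0e.
Qed.

Lemma ractE A M y i : nonneg A -> bounded_by A M -> vnonneg y ->
  (sqnorm y < +oo)%E -> (ract A y i)%:E = eact A y i.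
Proof.
move=> A0 AM y0 /sqnormP[b b0 yb].
by rewrite (EFin_fine_le _ (eact_le i A0 AM y0 b0 yb))// eact_ge0.
Qed.

(** Duality: v = A y is tested against its own restriction to a finite set F, normalised. The
    truncation is what makes the test vector square-summable before v is known to be. *)
Lemma sqnorm_ract A M b y : nonneg A -> bounded_by A M -> vnonneg y -> 0 <= b ->
  (sqnorm y <= (b ^+ 2)%:E)%E -> (sqnorm (ract A y) <= ((M * b) ^+ 2)%:E)%E.
Proof.
move=> A0 AM y0 b0 yb; set v := ract A y.
have v0 : vnonneg v by exact: ract_ge0.
have vE i : (v i)%:E = eact A y i by apply: (ractE _ A0 AM y0); exact: sqnorm_lty yb.
have Mb0 : 0 <= M * b by rewrite mulr_ge0//; exact: bounded_by_ge0 AM.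
apply: esumT_le => F; rewrite sumEFin lee_fin; set S := \sum_(i <- F) _.
have S0 : 0 <= S by apply: sumr_ge0 => i _; exact: sqr_ge0.
move: S0; rewrite le_eqVlt => /predU1P[<-|S0]; first exact: sqr_ge0.
pose s := Num.sqrt S; have s0 : 0 < s by rewrite sqrtr_gt0.
have sS : s ^+ 2 = S by rewrite sqr_sqrtr// ltW.
(* With s^2 = S the partial sum, x has norm 1 and the form at (x, y) equals S / s = s, so s <= M
   b. *)
pose x i := if i \in F then v i / s else 0.
have x0 : vnonneg x by move=> i; rewrite /x; case: ifP => // _; rewrite divr_ge0// ltW.
have x1 : (sqnorm x <= (1 ^+ 2)%:E)%E.
  rewrite /sqnorm.
  have -> : (fun i => (x i ^+ 2)%:E) =
      (fun i => if i \in F then ((v i / s) ^+ 2)%:E else 0%E).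
    by apply/funext => i; rewrite /x; case: ifP => // _; rewrite expr0n.
  rewrite esum_fset_if; last by move=> i; rewrite lee_fin sqr_ge0.
  under eq_bigr do rewrite exprMn exprVn.
  by rewrite sumEFin -mulr_suml -/S sS divff ?gt_eqF// expr1n.
have := bilin_le A0 AM x0 y0 ler01 b0 x1 yb; rewrite mulr1 bilinE//.
have -> : (fun i => (x i)%:E * eact A y i)%E =
    (fun i => if i \in F then (v i ^+ 2 / s)%:E else 0%E).
  apply/funext => i; rewrite -vE /x; case: ifP => _; last by rewrite mul0e.
  by rewrite -EFinM; congr _%:E; ring.
rewrite esum_fset_if; last by move=> i; rewrite lee_fin divr_ge0 ?sqr_ge0// ltW.
rewrite sumEFin -mulr_suml lee_fin -/S -sS expr2 mulfK ?gt_eqF// => sMb.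
by rewrite -expr2 ler_sqr// nnegrE ltW.
Qed.

Lemma esum_CauchySchwarz a b x y : vnonneg x -> vnonneg y -> 0 <= a -> 0 <= b ->
  (sqnorm x <= (a ^+ 2)%:E)%E -> (sqnorm y <= (b ^+ 2)%:E)%E ->
  (esumT (fun i => (x i * y i)%:E) <= (a * b)%:E)%E.
Proof.
move=> x0 y0; rewrite le_eqVlt => /predU1P[<- _|a0].
  rewrite expr0n mul0r => xz _; rewrite esum1// => i _.
  by rewrite (sqnorm_le0 i xz) mul0r.
rewrite le_eqVlt => /predU1P[<- _|b0 xa yb].
  rewrite expr0n mulr0 => yz; rewrite esum1// => i _.
  by rewrite (sqnorm_le0 i yz) mulr0.
(* These weights give p a^2 + q b^2 = a b, while p x^2 + q y^2 - x y = (b x - a y)^2 / (2 a b) is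
   non-negative termwise. *)
pose p := b / a / 2; pose q := a / b / 2.
have p0 : 0 <= p by rewrite !divr_ge0// ltW.
have q0 : 0 <= q by rewrite !divr_ge0// ltW.
apply: (@le_trans _ _ (p%:E * sqnorm x + q%:E * sqnorm y)%E).
  have sq0 (z : I -> K) i : (0 <= (z i ^+ 2)%:E)%E by rewrite lee_fin sqr_ge0.
  rewrite /sqnorm -!esumZl// -esumD; last 2 first.
  - by move=> i _; rewrite mule_ge0.
  - by move=> i _; rewrite mule_ge0.
  apply: le_esum => i _; rewrite -!EFinM -EFinD lee_fin -subr_ge0.
  have -> : p * x i ^+ 2 + q * y i ^+ 2 - x i * y i =
            (b * x i - a * y i) ^+ 2 / (2 * a * b).
    by rewrite /p /q; field; rewrite !gt_eqF.
  by rewrite divr_ge0 ?sqr_ge0// !mulr_ge0// ltW.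
have -> : (a * b)%:E = (p%:E * (a ^+ 2)%:E + q%:E * (b ^+ 2)%:E)%E.
  rewrite -!EFinM -EFinD; congr _%:E; rewrite /p /q; field.
  by rewrite !gt_eqF.
by apply: leeD; apply: lee_wpmul2l; rewrite ?lee_fin.
Qed.

(** Converse of [sqnorm_ract], by Cauchy-Schwarz. A real-valued majorant v of A y suffices, so the
    finiteness of A y comes as a consequence. *)
Lemma bounded_byP A M : nonneg A -> 0 <= M ->
  (forall y, vnonneg y -> (sqnorm y <= 1)%E -> exists v, [/\ vnonneg v,
    (forall i, eact A y i <= (v i)%:E)%E & (sqnorm v <= (M ^+ 2)%:E)%E]) ->
  bounded_by A M.
Proof.
move=> A0 M0 h x y x0 y0 x1 y1; have [v [v0 vE vM]] := h y y0 y1.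
rewrite bilinE//; have := esum_CauchySchwarz x0 v0 ler01 M0.
rewrite expr1n mul1r => /(_ x1 vM); apply: le_trans.
by apply: le_esum => i _; rewrite EFinM; apply: lee_wpmul2l; rewrite ?lee_fin.
Qed.

Lemma bounded_by_le A B M : (forall i j, A i j <= B i j) ->
  bounded_by B M -> bounded_by A M.
Proof.
move=> AB BM x y x0 y0 x1 y1; apply: le_trans (BM x y x0 y0 x1 y1).
apply: le_esum => i _; apply: le_esum => j _.
by rewrite lee_fin ler_wpM2r// ler_wpM2l.
Qed.

Lemma bounded_by_leM A M N : M <= N -> bounded_by A M -> bounded_by A N.
Proof.
by move=> MN AM x y *; apply: le_trans (AM x y _ _ _ _) _ => //; rewrite lee_fin.
Qed.

Lemma bounded_byZ A c M : nonneg A -> 0 <= c -> bounded_by A M ->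
  bounded_by (fun i j => c * A i j) (c * M).
Proof.
move=> A0 c0 AM x y x0 y0 x1 y1.
have -> : bilin (fun i j => c * A i j) x y = (c%:E * bilin A x y)%E.
  rewrite /bilin -esumZl//; last first.
    by move=> i; apply: esum_ge0 => j _; rewrite lee_fin !mulr_ge0.
  apply: eq_esum => i _; rewrite -esumZl//; last first.
    by move=> j; rewrite lee_fin !mulr_ge0.
  by apply: eq_esum => j _; rewrite -EFinM; congr _%:E; ring.
by rewrite EFinM; apply: lee_wpmul2l; [rewrite lee_fin|exact: AM].
Qed.

Lemma bounded_by_sum (J : choiceType) (s : seq J) (B : J -> imatrix K I) (M : J -> K) :
  (forall j, nonneg (B j)) -> (forall j, bounded_by (B j) (M j)) ->
  bounded_by (fun i k => \sum_(j <- s) B j i k) (\sum_(j <- s) M j).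
Proof.
move=> B0 BM x y x0 y0 x1 y1; rewrite /bilin.
have -> : (fun i => esumT (fun k => (x i * (\sum_(j <- s) B j i k) * y k)%:E)) =
    (fun i => \sum_(j <- s) esumT (fun k => (x i * B j i k * y k)%:E))%E.
  apply/funext => i; 
  rewrite -(@esum_sum _ _ _ setT s xpredT (fun k j => (x i * B j i k * y k)%:E)).
    by apply: eq_esum => k _; rewrite sumEFin mulr_sumr mulr_suml.
  by move=> k j _ _; rewrite lee_fin !mulr_ge0//; apply: B0.
rewrite esum_sum; last first.
  by move=> i j _ _; apply: esum_ge0 => k _; rewrite lee_fin !mulr_ge0//; apply: B0.
by rewrite -sumEFin; apply: lee_sum => j _; exact: BM.
Qed.

Lemma bounded_by_tr A M : nonneg A -> bounded_by A M -> bounded_by (mxtr A) M.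
Proof.
move=> A0 AM x y x0 y0 x1 y1; apply: le_trans (AM y x y0 x0 y1 x1).
rewrite /bilin esum_swap; last by move=> i j; rewrite lee_fin !mulr_ge0//; apply: A0.
apply: le_esum => i _; apply: le_esum => j _; rewrite lee_fin /mxtr.
by rewrite le_eqVlt; apply/orP; left; apply/eqP; ring.
Qed.

Lemma eact_id y i : vnonneg y -> eact (mxid K (I:=I)) y i = (y i)%:E.
Proof.
move=> y0; rewrite /eact (@esum_only _ _ _ i) /mxid.
- by rewrite eqxx mul1r.
- by move=> j; rewrite lee_fin mulr_ge0.
- by move=> j; rewrite eq_sym => /negPf ->; rewrite mul0r.
Qed.

Lemma nonneg_id : nonneg (mxid K (I:=I)).
Proof. by move=> i j; exact: ler0n. Qed.

Lemma bounded_by_id : bounded_by (mxid K (I:=I)) 1.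
Proof.
apply: bounded_byP; [exact: nonneg_id|by []|move=> y y0 y1].
by exists y; split; rewrite ?expr1n// => i; rewrite eact_id.
Qed.

(** * Products of bounded non-negative matrices *)

Lemma rsum_ge0E (J : choiceType) (f : J -> K) : (forall i, 0 <= f i) ->
  rsum f = fine (esumT (fun i => (f i)%:E)).
Proof.
move=> f0; rewrite /rsum [X in _ - fine X]esum1 ?subr0.
  by congr fine; apply: eq_esum => i _; rewrite max_l.
by move=> i _; rewrite max_r// oppr_le0.
Qed.

(** For non-negative matrices this is equivalent to [defines_operator], by [defines_operator_posop]
    and [posop_defines_operator]; it is the form preserved by all constructions below. *)
Definition posop A := nonneg A /\ exists M, bounded_by A M.

Lemma mxprod_ge0 A B : nonneg A -> nonneg B -> nonneg (mxprod A B).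
Proof.
move=> A0 B0 i j; rewrite /mxprod rsum_ge0E => [|k]; last exact: mulr_ge0.
by rewrite fine_ge0// esum_ge0// => k _; rewrite lee_fin mulr_ge0.
Qed.

(** The column of index j is the image of a basis vector. *)
Lemma sqnorm_col A M j : nonneg A -> bounded_by A M ->
  (sqnorm (A ^~ j) <= (M ^+ 2)%:E)%E.
Proof.
move=> A0 AM; have d0 : vnonneg (fun k => (k == j)%:R) by move=> k; exact: ler0n.
have := sqnorm_ract A0 AM d0 ler01; rewrite expr1n mulr1 sqnorm_delta.
move=> /(_ (lexx _)); congr (sqnorm _ <= _)%E; apply/funext => i.
rewrite /ract /eact (@esum_only _ _ _ j)/= ?eqxx ?mulr1//.
  by move=> k; rewrite lee_fin mulr_ge0.
by move=> k /negPf ->; rewrite mulr0.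
Qed.

(** The entry is a coordinate of A applied to a column of B, which is square-summable; hence the
    series is finite and nothing is lost in [rsum]. *)
Lemma mxprodE A B i j : posop A -> posop B ->
  (mxprod A B i j)%:E = esumT (fun k => (A i k * B k j)%:E).
Proof.
move=> [A0 [M AM]] [B0 [N BN]]; rewrite /mxprod rsum_ge0E => [|k]; last exact: mulr_ge0.
have Bj0 : vnonneg (B ^~ j) by move=> k; exact: B0.
by rewrite -[RHS](ractE i A0 AM Bj0 (sqnorm_lty (sqnorm_col j B0 BN))).
Qed.

(** Tonelli for the non-negative double family A_ik B_kj y_j. *)
Lemma eact_prod A B y i : posop A -> posop B -> vnonneg y -> (sqnorm y < +oo)%E ->
  eact (mxprod A B) y i = eact A (ract B y) i.
Proof.
move=> Ab Bb y0 yoo; have [A0 _] := Ab; have [B0 [N BN]] := Bb.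
transitivity (esumT (fun j => esumT (fun k => (A i k * B k j * y j)%:E))).
  apply: eq_esum => j _; rewrite EFinM mxprodE// muleC -esumZl//; last first.
    by move=> k; rewrite lee_fin mulr_ge0.
  by apply: eq_esum => k _; rewrite muleC.
rewrite esum_swap; last by move=> j k; rewrite lee_fin !mulr_ge0.
apply: eq_esum => k _; rewrite EFinM (ractE _ B0 BN)// /eact -esumZl//.
  by apply: eq_esum => j _; rewrite -EFinM mulrA.
by move=> j; rewrite lee_fin mulr_ge0.
Qed.

Lemma bounded_by_prod A B M N : nonneg A -> nonneg B ->
  bounded_by A M -> bounded_by B N -> bounded_by (mxprod A B) (M * N).
Proof.
move=> A0 B0 AM BN; have [M0 N0] := (bounded_by_ge0 AM, bounded_by_ge0 BN).
apply: bounded_byP; [exact: mxprod_ge0|exact: mulr_ge0|move=> y y0 y1].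
have Bb : posop B by split => //; exists N.
have Ab : posop A by split => //; exists M.
have By0 := ract_ge0 B0 y0.
have yoo : (sqnorm y < +oo)%E by exact: sqnorm_lty y1.
have := sqnorm_ract B0 BN y0 ler01; rewrite expr1n mulr1 => /(_ y1) ByN.
exists (ract A (ract B y)); split; first exact: ract_ge0.
  by move=> i; rewrite eact_prod// (ractE _ A0 AM)//; exact: sqnorm_lty ByN.
exact: sqnorm_ract.
Qed.

Lemma posop_prod A B : posop A -> posop B -> posop (mxprod A B).
Proof.
move=> [A0 [M AM]] [B0 [N BN]]; split; first exact: mxprod_ge0.
by exists (M * N); exact: bounded_by_prod.
Qed.

Lemma posop_id : posop (mxid K (I:=I)).
Proof. by split; [exact: nonneg_id|exists 1; exact: bounded_by_id]. Qed.

Lemma posop_tr A : posop A -> posop (mxtr A).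
Proof.
by move=> [A0 [M AM]]; split=> [i j|]; [exact: A0|exists M; exact: bounded_by_tr].
Qed.

Lemma mxprod_le A A' B B' : posop A -> posop A' -> posop B -> posop B' ->
  (forall i j, A i j <= A' i j) -> (forall i j, B i j <= B' i j) ->
  forall i j, mxprod A B i j <= mxprod A' B' i j.
Proof.
move=> Ab A'b Bb B'b AA BB i j; rewrite -lee_fin !mxprodE//; apply: le_esum => k _.
by rewrite lee_fin ler_pM//; [case: Ab|case: Bb].
Qed.

Lemma mxprodA A B C : posop A -> posop B -> posop C ->
  mxprod A (mxprod B C) = mxprod (mxprod A B) C.
Proof.
move=> Ab Bb Cb; apply/funext => i; apply/funext => j; apply: EFin_inj.
rewrite !mxprodE//; [|exact: posop_prod..].
have [[A0 _] [B0 _] [C0 _]] := And3 Ab Bb Cb.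
transitivity (esumT (fun k => esumT (fun l => (A i k * B k l * C l j)%:E))).
  apply: eq_esum => k _; rewrite EFinM mxprodE// -esumZl//.
    by apply: eq_esum => l _; rewrite -EFinM mulrA.
  by move=> l; rewrite lee_fin mulr_ge0.
rewrite esum_swap; last by move=> k l; rewrite lee_fin !mulr_ge0.
apply: eq_esum => l _; rewrite EFinM mxprodE// muleC -esumZl//.
  by apply: eq_esum => k _; rewrite -EFinM mulrC.
by move=> k; rewrite lee_fin mulr_ge0.
Qed.

Lemma mxprod1l A : nonneg A -> mxprod (mxid K (I:=I)) A = A.
Proof.
move=> A0; apply/funext => i; apply/funext => j.
rewrite /mxprod rsum_ge0E => [|k]; last by rewrite mulr_ge0 ?ler0n.
rewrite (@esum_only _ _ _ i) /mxid ?eqxx ?mul1r// => [k|k].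
  by rewrite lee_fin mulr_ge0.
by rewrite eq_sym => /negPf ->; rewrite mul0r.
Qed.

Lemma mxprod1r A : nonneg A -> mxprod A (mxid K (I:=I)) = A.
Proof.
move=> A0; apply/funext => i; apply/funext => j.
rewrite /mxprod rsum_ge0E => [|k]; last by rewrite mulr_ge0 ?ler0n.
rewrite (@esum_only _ _ _ j) /mxid ?eqxx ?mulr1// => [k|k].
  by rewrite lee_fin mulr_ge0.
by move=> /negPf ->; rewrite mulr0.
Qed.

End BoundedMatrices.

(** * Hadamard geometric means *)

Section GeometricMean.
Variables (K : realType) (I : choiceType) (m : nat) (al : K).
Hypotheses (al_gt0 : 0 < al) (m_al : 1 <= m%:R * al).
Implicit Types (B C : 'I_m -> imatrix K I).

Let m_gt0 : (0 < m)%N.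
Proof.
by rewrite lt0n; apply/eqP => m0; move: m_al; rewrite m0 mul0r ler10.
Qed.

(** On [0, 1] a larger exponent gives a smaller power, so al >= 1/m reduces the claim to the
    exponent 1/m, which is the inequality between geometric and arithmetic means. *)
Lemma geom_le_mean (u : 'I_m -> K) : (forall l, 0 <= u l <= 1) ->
  \prod_l u l `^ al <= m%:R^-1 * \sum_l u l.
Proof.
move=> u01; have mK0 : m%:R != 0 :> K by rewrite pnatr_eq0 -lt0n.
apply: (@le_trans _ _ (\prod_l u l `^ m%:R^-1)).
  apply: ler_prod => l _; rewrite powR_ge0/=.
  have /andP[] := u01 l; rewrite le_eqVlt => /predU1P[<- _|u0 u1].
    by rewrite !powR0 ?invr_eq0// gt_eqF.
  apply: ger_powR; first by rewrite u0.
  by rewrite -div1r ler_pdivrMr ?ltr0n// mulrC.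
have P0 : 0 <= \prod_l u l `^ m%:R^-1 by apply: prodr_ge0 => l _; exact: powR_ge0.
have S0 : 0 <= m%:R^-1 * \sum_l u l.
  rewrite mulr_ge0 ?invr_ge0 ?ler0n// sumr_ge0// => l _.
  by have /andP[] := u01 l.
rewrite -(ler_pXn2r m_gt0) ?nnegrE//.
have -> : (\prod_l u l `^ m%:R^-1) ^+ m = \prod_l u l.
  rewrite -prodrXl; apply: eq_bigr => l _.
  have /andP[u0 _] := u01 l.
  by rewrite -powR_mulrn ?powR_ge0// -powRrM mulVf// powRr1.
have := @leif_AGM K 'I_m predT u; rewrite card_ord mulrC => h.
by apply: (leif_le (h _)) => l _; have /andP[] := u01 l.
Qed.

(** [geom_le_mean] for the quotients a_l / c_l. The bound is linear in a, with weights depending on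
    c only, so it can be summed over entries or read as a bound between matrices. *)
Lemma geom_le_weighted (c a : 'I_m -> K) : (forall l, 0 < c l) ->
  (forall l, 0 <= a l <= c l) ->
  \prod_l a l `^ al <=
  \sum_l ((\prod_l c l `^ al) * m%:R^-1 * (c l)^-1) * a l.
Proof.
move=> c0 ac.
have -> : \prod_l a l `^ al = (\prod_l c l `^ al) * \prod_l (a l / c l) `^ al.
  rewrite -big_split/=; apply: eq_bigr => l _.
  have /andP[a0 _] := ac l.
  rewrite -powRM ?divr_ge0 ?(ltW (c0 l))//; congr (_ `^ _).
  by rewrite mulrC divfK// gt_eqF.
apply: (@le_trans _ _ ((\prod_l c l `^ al) * (m%:R^-1 * \sum_l (a l / c l)))).
  apply: ler_wpM2l; first by apply: prodr_ge0 => l _; exact: powR_ge0.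
  apply: geom_le_mean => l; have /andP[a0 acl] := ac l.
  by rewrite divr_ge0 ?(ltW (c0 l))//= ler_pdivrMr ?mul1r.
rewrite !mulr_sumr; apply: ler_sum => l _.
by rewrite le_eqVlt; apply/orP; left; apply/eqP; ring.
Qed.

(** The linear bound is an equality at a = c; this is why no constant is lost after summation. *)
Lemma weighted_total (c : 'I_m -> K) : (forall l, 0 < c l) ->
  \sum_l ((\prod_l c l `^ al) * m%:R^-1 * (c l)^-1) * c l = \prod_l c l `^ al.
Proof.
move=> c0; transitivity (\sum_(l < m) (\prod_l c l `^ al) * m%:R^-1).
  by apply: eq_bigr => l _; rewrite divfK// gt_eqF.
rewrite sumr_const card_ord -[LHS]mulr_natr divfK//.
by rewrite pnatr_eq0 -lt0n.
Qed.

Lemma weight_ge0 (c : 'I_m -> K) l : (forall l, 0 < c l) ->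
  0 <= (\prod_l c l `^ al) * m%:R^-1 * (c l)^-1.
Proof.
move=> c0; rewrite !mulr_ge0 ?invr_ge0 ?(ltW (c0 _))//.
by apply: prodr_ge0 => k _; exact: powR_ge0.
Qed.

(** A bound c_l on the total of a_l also bounds each of its terms, so the linear bound applies
    termwise; summing it gives the value at a = c. *)
Lemma holder_esum (J : choiceType) (a : 'I_m -> J -> K) (c : 'I_m -> K) :
  (forall l k, 0 <= a l k) ->
  (forall l, (esumT (fun k => (a l k)%:E) <= (c l)%:E)%E) ->
  (esumT (fun k => (\prod_l a l k `^ al)%:E) <= (\prod_l c l `^ al)%:E)%E.
Proof.
move=> a0 ac.
have acl l k : a l k <= c l.
  rewrite -lee_fin; apply: le_trans (ac l).
  by apply: (@ge_esum1 _ _ (fun k => (a l k)%:E)) => j; rewrite lee_fin.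
(* If some c_l is not positive, then the family a_l is zero, and the factor 0^al = 0 kills every
   term because al > 0. *)
have [c0|] := pselect (forall l, 0 < c l); last first.
  move/existsNP => [l /negP]; rewrite -leNgt => cl0.
  rewrite esum1; first by rewrite lee_fin; apply: prodr_ge0 => k _; exact: powR_ge0.
  move=> k _; rewrite (bigD1 l)//= (_ : a l k = 0) ?powR0 ?mul0r ?gt_eqF//.
  by apply/eqP; rewrite eq_le a0 andbT (le_trans (acl _ _)).
rewrite -(weighted_total c0).
set w := fun l => (\prod_l c l `^ al) * m%:R^-1 * (c l)^-1.
apply: (@le_trans _ _ (esumT (fun k => (\sum_l (w l)%:E * (a l k)%:E)%E))).
  apply: le_esum => k _; rewrite sumEFin lee_fin geom_le_weighted// => l.
  by rewrite a0 acl.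
rewrite esum_sum; last by move=> k l _ _; rewrite mule_ge0 ?lee_fin ?weight_ge0.
rewrite -sumEFin; apply: lee_sum => l _.
rewrite esumZl ?weight_ge0// ?EFinM; last by move=> k; rewrite lee_fin.
by apply: lee_wpmul2l; rewrite ?lee_fin ?weight_ge0.
Qed.

(** The genuine geometric mean is al = 1/m; al = 1 gives Hadamard products and m = 1 gives Hadamard
    powers, so one theory serves every link of the chain. *)
Definition geomean B : imatrix K I := hadamard (fun l => hpow (B l) al).

Lemma geomean_ge0 B : nonneg (geomean B).
Proof. by move=> i j; apply: prodr_ge0 => l _; exact: powR_ge0. Qed.

Lemma entry_le (A : imatrix K I) M i j : nonneg A -> bounded_by A M -> A i j <= M.
Proof.
move=> A0 AM; have d0 : vnonneg (fun k => (k == j)%:R : K) by move=> k; exact: ler0n.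
have := eact_le i A0 AM d0 ler01; rewrite expr1n mulr1 sqnorm_delta => /(_ (lexx _)).
rewrite /eact (@esum_only _ _ _ j)/= ?eqxx ?mulr1 ?lee_fin//.
  by move=> k; rewrite lee_fin mulr_ge0.
by move=> k /negPf ->; rewrite mulr0.
Qed.

(** Entries are at most the norm bound c_l, so the linear bound dominates the mean entrywise by a
    combination of the B_l with weights w_l, whose norm is at most the sum of the w_l c_l. *)
Lemma bounded_by_geomean B (c : 'I_m -> K) : (forall l, 0 < c l) ->
  (forall l, nonneg (B l)) -> (forall l, bounded_by (B l) (c l)) ->
  bounded_by (geomean B) (\prod_l c l `^ al).
Proof.
move=> c0 B0 Bc; pose w l := (\prod_l c l `^ al) * m%:R^-1 * (c l)^-1.
apply: (@bounded_by_le _ _ _ (fun i j => \sum_l w l * B l i j)) => [i j|].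
  by apply: geom_le_weighted => // l; rewrite B0 entry_le.
rewrite -(weighted_total c0).
apply: (@bounded_by_sum _ _ _ _ (fun l i j => w l * B l i j)).
  by move=> l i j; rewrite mulr_ge0 ?weight_ge0//; apply: B0.
by move=> l; apply: bounded_byZ => //; rewrite weight_ge0.
Qed.

Lemma posop_gt0 (A : imatrix K I) : posop A -> exists2 M, 0 < M & bounded_by A M.
Proof.
move=> [A0 [M AM]]; exists (M + 1); first by rewrite ltr_wpDl// (bounded_by_ge0 AM).
by apply: bounded_by_leM AM; rewrite lerDl.
Qed.

Lemma posop_geomean B : (forall l, posop (B l)) -> posop (geomean B).
Proof.
move=> Bb; split; first exact: geomean_ge0.
have /choice[c cP] : forall l, exists M, 0 < M /\ bounded_by (B l) M.
  by move=> l; have [M M0 BM] := posop_gt0 (Bb l); exists M.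
exists (\prod_l c l `^ al); apply: bounded_by_geomean => l; last by case: (cP l).
  by case: (cP l).
by case: (Bb l).
Qed.

(** Hoelder over the summation index k, applied to the families B_l(i,k) C_l(k,j) for fixed i and
    j. *)
Lemma geomean_prod B C i j : (forall l, posop (B l)) -> (forall l, posop (C l)) ->
  mxprod (geomean B) (geomean C) i j <= geomean (fun l => mxprod (B l) (C l)) i j.
Proof.
move=> Bb Cb; rewrite -lee_fin mxprodE; [|exact: posop_geomean..].
have -> : (fun k => (geomean B i k * geomean C k j)%:E) =
    (fun k => (\prod_l (B l i k * C l k j) `^ al)%:E).
  apply/funext => k; rewrite /geomean /hadamard -big_split/=; congr _%:E.
  by apply: eq_bigr => l _; rewrite /hpow powRM//; [case: (Bb l)|case: (Cb l)].
apply: (@holder_esum _ (fun l k => B l i k * C l k j)).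
  by move=> l k; rewrite mulr_ge0//; [case: (Bb l)|case: (Cb l)].
by move=> l; rewrite mxprodE.
Qed.

Lemma posop_seq (J : Type) (F : J -> imatrix K I) (r : seq J) :
  (forall j, posop (F j)) -> posop (mxprod_seq [seq F j | j <- r]).
Proof.
by move=> Fb; elim: r => [|j r ih]; [exact: posop_id|exact: posop_prod].
Qed.

Lemma geomean_id : geomean (fun=> mxid K (I:=I)) = mxid K (I:=I).
Proof.
apply/funext => i; apply/funext => j; rewrite /geomean /hadamard /hpow /mxid.
case: eqP => _; first by rewrite big1// => l _; rewrite powR1.
(* Off the diagonal one factor 0^al = 0 is enough: m > 0 provides a factor and al > 0 rules out 0^0
   = 1. *)
by rewrite (bigD1 (Ordinal m_gt0))//= powR0 ?mul0r// gt_eqF.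
Qed.

Lemma geomean_seq (J : Type) (F : J -> 'I_m -> imatrix K I) (r : seq J) i k :
  (forall j l, posop (F j l)) ->
  mxprod_seq [seq geomean (F j) | j <- r] i k <=
  geomean (fun l => mxprod_seq [seq F j l | j <- r]) i k.
Proof.
move=> Fb; elim: r i k => [|j r ih] i k /=; first by rewrite geomean_id.
apply: le_trans (geomean_prod i k (Fb j) _); last by move=> l; exact: posop_seq.
apply: mxprod_le => //.
- exact: posop_geomean.
- exact: posop_geomean.
- by apply: posop_seq => j'; exact: posop_geomean.
- by apply: posop_geomean => l; exact: posop_seq.
Qed.

End GeometricMean.

(** * Growth of powers *)

Section Powers.
Variables (K : realType) (I : choiceType).
Implicit Types (A B : imatrix K I) (lam mu : K).

Definition mxpow A n : imatrix K I := iter n (mxprod A) (mxid K (I:=I)).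

Lemma mxprod_seq_const (J : Type) A (r : seq J) :
  mxprod_seq [seq A | _ <- r] = mxpow A (size r).
Proof. by elim: r => //= j r ->. Qed.

Lemma posop_pow A n : posop A -> posop (mxpow A n).
Proof. by move=> Ab; elim: n => [|n ih]; [exact: posop_id|exact: posop_prod]. Qed.

Lemma mxpowD A n p : posop A -> mxpow A (n + p) = mxprod (mxpow A n) (mxpow A p).
Proof.
move=> Ab; have [Ap0 _] := posop_pow p Ab.
elim: n => [|n ih]; first by rewrite mxprod1l.
by rewrite addSn /mxpow/= -/(mxpow A _) ih mxprodA//; exact: posop_pow.
Qed.

Lemma mxpow1 A : posop A -> mxpow A 1 = A.
Proof. by case=> A0 _; rewrite /mxpow/= mxprod1r. Qed.

Lemma mxpowSr A n : posop A -> mxpow A n.+1 = mxprod (mxpow A n) A.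
Proof. by move=> Ab; rewrite -addn1 mxpowD// mxpow1. Qed.

Lemma mxpowM A n p : posop A -> mxpow A (n * p) = mxpow (mxpow A n) p.
Proof.
by move=> Ab; elim: p => [|p ih]; rewrite ?muln0// mulnS mxpowD// ih.
Qed.

Lemma mxpow_le A B n i j : posop A -> posop B -> (forall i j, A i j <= B i j) ->
  mxpow A n i j <= mxpow B n i j.
Proof.
move=> Ab Bb AB; elim: n i j => [|n ih] i j //=.
by apply: mxprod_le => //; exact: posop_pow.
Qed.

Lemma mxprod_seq_cat (J : Type) (F : J -> imatrix K I) (r s : seq J) :
  (forall j, posop (F j)) -> mxprod_seq [seq F j | j <- r ++ s] =
  mxprod (mxprod_seq [seq F j | j <- r]) (mxprod_seq [seq F j | j <- s]).
Proof.
move=> Fb; have [s0 _] := posop_seq s Fb.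
elim: r => [|j r ih]; first by rewrite /= mxprod1l.
by rewrite /= ih mxprodA//; exact: posop_seq.
Qed.

(** The factor C absorbs the boundary terms produced by taking roots and by rotating a product. *)
Definition growth A lam :=
  exists2 C, 0 < C & forall n, bounded_by (mxpow A n) (C * lam ^+ n).

Lemma growth_intro A lam C : 0 <= lam ->
  (forall n, bounded_by (mxpow A n) (C * lam ^+ n)) -> growth A lam.
Proof.
move=> l0 h; exists (`|C| + 1) => [|n]; first by rewrite ltr_wpDl.
apply: bounded_by_leM (h n); rewrite ler_wpM2r ?exprn_ge0//.
by rewrite (le_trans (ler_norm _))// lerDl.
Qed.

Lemma growth_le A B lam : posop A -> posop B -> (forall i j, A i j <= B i j) ->
  growth B lam -> growth A lam.
Proof.
move=> Ab Bb AB [C C0 h]; exists C; first exact: C0.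
by move=> n; apply: bounded_by_le (h n) => i j; exact: (mxpow_le n i j Ab Bb AB).
Qed.

Lemma growth_leM A lam mu : 0 <= lam -> lam <= mu -> growth A lam -> growth A mu.
Proof.
move=> l0 lm [C C0 h]; exists C => // n; apply: bounded_by_leM (h n).
by rewrite ler_wpM2l ?(ltW C0)// lerXn2r ?nnegrE// (le_trans l0).
Qed.

Lemma growth_bounded_by A M : nonneg A -> bounded_by A M -> growth A M.
Proof.
move=> A0 AM; have Ab : posop A by split => //; exists M.
exists 1 => // n; rewrite mul1r.
elim: n => [|n ih]; first exact: bounded_by_id.
by rewrite exprS; apply: bounded_by_prod => //; case: (posop_pow n Ab).
Qed.

(** Euclidean division n = q p + s: the power A^(q p) is controlled by hypothesis, and only finitely
    many remainders s < p occur. *)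
Lemma growth_root A lam p : posop A -> 0 < lam -> (0 < p)%N ->
  growth (mxpow A p) (lam ^+ p) -> growth A lam.
Proof.
move=> Ab l0 p0 [C C0 h]; have [M M0 AM] := posop_gt0 Ab.
have [D D0 hM] := growth_bounded_by Ab.1 AM.
(* The sum over all remainders dominates the term of the one remainder that occurs for n. *)
apply: (@growth_intro _ _ (C * \sum_(s < p) (D * (M / lam) ^+ s))) => [|n]; first exact: ltW.
rewrite {1}(divn_eq n p) mulnC mxpowD//.
pose s0 := Ordinal (ltn_pmod n p0).
have Ann k : nonneg (mxpow A k) by case: (posop_pow k Ab).
have hn := h (n %/ p)%N; rewrite -mxpowM// in hn.
apply: bounded_by_leM (bounded_by_prod (Ann _) (Ann _) hn (hM (n %% p)%N)).
set q := (n %/ p)%N; set S := \sum_(s < p) _.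
have -> : C * S * lam ^+ n = C * (lam ^+ p) ^+ q * (S * lam ^+ s0).
  by rewrite {1}(divn_eq n p) exprD mulnC exprM /=; ring.
rewrite ler_wpM2l ?mulr_ge0 ?exprn_ge0 ?(ltW C0) ?(ltW l0)//.
have -> : D * M ^+ (n %% p) = D * (M / lam) ^+ s0 * lam ^+ s0.
  by rewrite exprMn exprVn -mulrA divfK// expf_neq0// gt_eqF.
rewrite ler_wpM2r ?exprn_ge0 ?(ltW l0)// /S (bigD1 s0)//= lerDl.
by apply: sumr_ge0 => s _; rewrite mulr_ge0 ?exprn_ge0 ?divr_ge0 ?(ltW D0)
  ?(ltW M0) ?(ltW l0).
Qed.

Lemma growth_cycle A B lam : posop A -> posop B -> 0 < lam ->
  growth (mxprod A B) lam -> growth (mxprod B A) lam.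
Proof.
move=> Ab Bb l0 [C C0 h]; have [M M0 AM] := posop_gt0 Ab.
have [N N0 BN] := posop_gt0 Bb.
have ABb := posop_prod Ab Bb; have BAb := posop_prod Bb Ab.
(* Rotation costs one exponent, (B A)^(n+1) = B (A B)^n A; this is the factor 1 / lam in the
   constant below, whose summand 1 covers the exponent 0. *)
have E n : mxpow (mxprod B A) n.+1 = mxprod (mxprod B (mxpow (mxprod A B) n)) A.
  elim: n => [|n ih]; first by rewrite mxpow1//= mxprod1r//; case: Bb.
  have Pb := posop_pow n ABb.
  rewrite /mxpow iterS -/(mxpow _ _) ih iterS -/(mxpow _ _).
  rewrite (mxprodA BAb (posop_prod Bb Pb) Ab) -(mxprodA Bb Ab (posop_prod Bb Pb)).
  by rewrite (mxprodA Ab Bb Pb).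
have [A0 _] := Ab; have [B0 _] := Bb.
apply: (@growth_intro _ _ (1 + N * C * M / lam)) => [|[|n]]; first exact: ltW.
  rewrite expr0 mulr1; apply: bounded_by_leM (@bounded_by_id K I).
  by rewrite lerDl !mulr_ge0 ?invr_ge0// ltW.
have [P0 _] := posop_pow n ABb.
rewrite E; apply: bounded_by_leM (bounded_by_prod (mxprod_ge0 B0 P0) A0
  (bounded_by_prod B0 P0 BN (h n)) AM).
rewrite mulrDl exprS mul1r -[leLHS]add0r lerD ?mulr_ge0 ?exprn_ge0 ?(ltW l0)//.
rewrite le_eqVlt; apply/orP; left; apply/eqP; field.
by rewrite gt_eqF.
Qed.

(** By iterated Hoelder the n-th power of the mean lies entrywise below the mean of the n-th powers,
    to which the norm bound for means applies. *)
Lemma growth_geomean m (al : K) (B : 'I_m -> imatrix K I) (lam : 'I_m -> K) :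
  0 < al -> 1 <= m%:R * al ->
  (forall l, posop (B l)) -> (forall l, 0 < lam l) ->
  (forall l, growth (B l) (lam l)) ->
  growth (geomean al B) (\prod_l lam l `^ al).
Proof.
move=> al0 mal Bb l0 h.
have /choice[C CP] : forall l, exists C, 0 < C /\
    forall n, bounded_by (mxpow (B l) n) (C * lam l ^+ n).
  by move=> l; have [C C0 hC] := h l; exists C.
exists (\prod_l C l `^ al) => [|n].
  by apply: prodr_gt0 => l _; rewrite powR_gt0//; case: (CP l).
have -> : (\prod_l C l `^ al) * (\prod_l lam l `^ al) ^+ n =
    \prod_l (C l * lam l ^+ n) `^ al.
  rewrite -prodrXl -big_split/=; apply: eq_bigr => l _; have [Cl0 _] := CP l.
  rewrite powRM ?exprn_ge0 ?(ltW (l0 l)) ?(ltW Cl0)//; congr (_ * _).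
  have l0' := ltW (l0 l).
  by rewrite -(powR_mulrn n l0') -(powR_mulrn n (powR_ge0 _ al)) powRAC.
apply: (@bounded_by_le _ _ _ (geomean al (fun l => mxpow (B l) n))) => [i j|].
  have := @geomean_seq _ _ _ _ al0 mal _ (fun=> B) (iota 0 n) i j (fun _ => Bb).
  rewrite mxprod_seq_const size_iota.
  congr (_ <= geomean _ _ _ _); apply/funext => l.
  by rewrite mxprod_seq_const size_iota.
apply: bounded_by_geomean => // l.
- by have [Cl0 _] := CP l; rewrite mulr_gt0 ?exprn_gt0.
- by case: (posop_pow n (Bb l)).
- by case: (CP l).
Qed.

Lemma mxtr_prod A B : mxtr (mxprod A B) = mxprod (mxtr B) (mxtr A).
Proof.
apply/funext => i; apply/funext => j; rewrite /mxtr /mxprod; congr rsum.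
by apply/funext => k; rewrite mulrC.
Qed.

Lemma mxtr_pow A n : posop A -> mxtr (mxpow A n) = mxpow (mxtr A) n.
Proof.
move=> Ab; elim: n => [|n ih].
  by apply/funext => i; apply/funext => j; rewrite /mxtr/= /mxid eq_sym.
by rewrite mxpowSr// mxtr_prod ih.
Qed.

(** Bernoulli inequality. *)
Lemma expr_ge_linear (d : K) n : 0 <= d -> 1 + n%:R * d <= (1 + d) ^+ n.
Proof.
move=> d0; elim: n => [|n ih]; first by rewrite mul0r addr0.
rewrite exprS; apply: (@le_trans _ _ ((1 + d) * (1 + n%:R * d))); last first.
  by rewrite ler_wpM2l// addr_ge0.
rewrite -natr1 -subr_ge0 (_ : _ - _ = n%:R * d ^+ 2); last by ring.
by rewrite mulr_ge0 ?sqr_ge0.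
Qed.

(** Were w > lam, the powers of w / lam would be unbounded by Bernoulli, against the bound C. *)
Lemma le_of_expr_le (w lam C : K) : 0 < lam ->
  (forall k, w ^+ (2 ^ k) <= C * lam ^+ (2 ^ k)) -> w <= lam.
Proof.
move=> l0 h; rewrite leNgt; apply/negP => lw.
pose d := w / lam - 1; have d0 : 0 < d by rewrite subr_gt0 ltr_pdivlMr// mul1r.
have hk k : 1 + (2 ^ k)%:R * d <= C.
  apply: le_trans (expr_ge_linear _ (ltW d0)) _.
  rewrite addrC subrK exprMn exprVn ler_pdivrMr ?exprn_gt0//.
have [k kC] : exists k : nat, C / d < k%:R.
  exists (Num.bound `|C / d|).
  exact: le_lt_trans (ler_norm _) (archi_boundP (normr_ge0 _)).
have := hk k; apply/negP; rewrite -ltNge.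
have : k%:R <= (2 ^ k)%:R :> K by rewrite ler_nat ltnW// ltn_expl.
move: kC; rewrite ltr_pdivrMr// => kC k2.
rewrite (lt_le_trans kC)// (@le_trans _ _ ((2 ^ k)%:R * d))//.
  by rewrite ler_wpM2r// ltW.
by rewrite lerDr.
Qed.

(** Adjointness: Tonelli moves one factor A of the square across the form as A^T. *)
Lemma sqnorm_sym A u : posop A -> vnonneg u -> (sqnorm u < +oo)%E ->
  sqnorm (ract A u) = esumT (fun i => (u i * ract (mxprod (mxtr A) A) u i)%:E).
Proof.
move=> Ab u0 uoo; have [A0 [M AM]] := Ab.
have Atb := posop_tr Ab; have [At0 _] := Atb.
have [b b0 ub] := sqnormP uoo.
have v0 : vnonneg (ract A u) by exact: ract_ge0.
have voo : (sqnorm (ract A u) < +oo)%E.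
  by apply: sqnorm_lty; exact: (sqnorm_ract A0 AM u0 b0 ub).
transitivity (bilin A (ract A u) u).
  by rewrite bilinE//; apply: eq_esum => i _; rewrite -(ractE _ A0 AM)// -EFinM expr2.
transitivity (bilin (mxtr A) u (ract A u)).
  rewrite /bilin esum_swap; last by move=> i j; rewrite lee_fin !mulr_ge0.
  by apply: eq_esum => i _; apply: eq_esum => j _; congr _%:E; rewrite /mxtr; ring.
rewrite bilinE//; apply: eq_esum => i _; rewrite EFinM; congr (_ * _)%E.
rewrite -eact_prod//; have [P0 [N PN]] := posop_prod Atb Ab.
by rewrite (ractE _ P0 PN).
Qed.

(* For B = A A^T and |y| <= 1, Cauchy-Schwarz gives |A^T y|^2 <= |B y| and
   |B^k y|^2 <= |B^(2k) y|, so |A^T y|^2 <= (C lam^(2^k))^(1/2^k) for all k. *)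
Lemma growth_gram A lam : posop A -> 0 < lam ->
  growth (mxprod A (mxtr A)) lam -> bounded_by A (Num.sqrt lam).
Proof.
move=> Ab l0 [C C0 h]; have Atb := posop_tr Ab; have [A0 _] := Ab.
suff : bounded_by (mxtr A) (Num.sqrt lam) by apply: bounded_by_tr; case: Atb.
have [At0 _] := Atb.
apply: bounded_byP; [by []|exact: sqrtr_ge0|move=> y y0 y1].
have yoo : (sqnorm y < +oo)%E := sqnorm_lty y1.
exists (ract (mxtr A) y); split; first exact: ract_ge0.
  by have [_ [M AtM]] := Atb; move=> i; rewrite (ractE _ At0 AtM).
have [_ [M AtM]] := Atb.
have := sqnorm_ract At0 AtM y0 ler01; rewrite expr1n mulr1 => /(_ y1) vM.
set v := ract (mxtr A) y in vM *.
rewrite -(EFin_fine_le (sqnorm_ge0 v) vM) lee_fin sqr_sqrtr ?(ltW l0)//.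
set B := mxprod A (mxtr A) in h *; have Bb : posop B by exact: posop_prod.
have Bs : mxtr B = B by rewrite /B mxtr_prod.
pose S k := mxpow B (2 ^ k); have Sb k : posop (S k) by exact: posop_pow.
have SS k : mxprod (mxtr (S k)) (S k) = S k.+1.
  by rewrite mxtr_pow// Bs -mxpowD// addnn -mul2n -expnS.
pose z k := Num.sqrt (fine (sqnorm (ract (S k) y))).
have fin k : (sqnorm (ract (S k) y) <= ((C * lam ^+ (2 ^ k)) ^+ 2)%:E)%E.
  have [S0 _] := Sb k; have := sqnorm_ract S0 (h _) y0 ler01.
  by rewrite expr1n mulr1 => /(_ y1).
have zE k : (sqnorm (ract (S k) y) = (z k ^+ 2)%:E)%E.
  by rewrite sqr_sqrtr ?fine_ge0 ?sqnorm_ge0// (EFin_fine_le _ (fin k))// sqnorm_ge0.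
have zle k : z k <= C * lam ^+ (2 ^ k).
  rewrite -ler_sqr ?nnegrE ?sqrtr_ge0//; last by rewrite mulr_ge0 ?exprn_ge0// ltW.
  by rewrite -lee_fin -zE.
(* Cauchy-Schwarz for the pairing of y with S_k y. It is used with T = A^T at k = 0, and with T =
   S_k, which is symmetric, to pass from k to k + 1. *)
have CSk (T : imatrix K I) k : posop T -> mxprod (mxtr T) T = S k ->
    (sqnorm (ract T y) <= (z k)%:E)%E.
  move=> Tb TS; rewrite sqnorm_sym// TS; have [S0 _] := Sb k.
  have := esum_CauchySchwarz y0 (ract_ge0 S0 y0) ler01 (sqrtr_ge0 _ : 0 <= z k).
  by rewrite expr1n mul1r zE => /(_ y1 (lexx _)).
have w0 : fine (sqnorm v) <= z 0%N.
  rewrite -lee_fin (EFin_fine_le (sqnorm_ge0 v) vM); apply: CSk => //.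
  by rewrite /S expn0 mxpow1.
apply: (@le_of_expr_le _ _ C) => // k; apply: le_trans (zle k).
elim: k => [|k ih]; first by rewrite expn0 expr1.
rewrite expnSr exprM; apply: (@le_trans _ _ (z k ^+ 2)).
  by rewrite ler_sqr ?nnegrE ?sqrtr_ge0// exprn_ge0// fine_ge0// sqnorm_ge0.
by rewrite -lee_fin -zE; apply: CSk.
Qed.

End Powers.

(** * Neumann series *)

Section NatSums.
Variable K : realType.

Lemma geometric_esum (q : K) : 0 <= q < 1 ->
  (esumT (fun n : nat => (q ^+ n)%:E) <= ((1 - q)^-1)%:E)%E.
Proof.
move=> /andP[q0 q1]; apply: esumT_le => F.
(* A finite index set lies in an initial segment, where the geometric sum is explicit. *)
pose N := (\max_(i <- F) i).+1.
have FN : [set` F] `<=` `I_N.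
  by move=> i /= iF; rewrite ltnS; exact: (@leq_bigmax_seq _ (enum_fset F) xpredT id).
apply: le_trans (@lee_sum_fset_nat _ (fun n => (q ^+ n)%:E) F N xpredT _ FN) _.
  by move=> i _; rewrite lee_fin exprn_ge0.
rewrite sumEFin lee_fin -[leRHS]mul1r ler_pdivlMr ?subr_gt0// big_mkord mulrC.
rewrite -opprB mulNr -subrX1 opprB lerBlDr lerDl.
by rewrite exprn_ge0.
Qed.

Lemma esum_nat_recl (f : nat -> \bar K) : (forall n, 0 <= f n)%E ->
  esumT f = (f 0%N + esumT (fun n => f n.+1))%E.
Proof.
move=> f0; rewrite (esumID [set 0%N])// !setTI esum_set1//; congr (_ + _)%E.
apply: (reindex_esum _ _ S); split => //=; first by move=> n m _ _ [].
by move=> [|n] //= _; exists n.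
Qed.

End NatSums.

(** * Linearity of the matrix product and positive resolvents *)

Section MatrixLinearity.
Variables (K : realType) (I : choiceType).
Implicit Types (A B C : imatrix K I).

Lemma mxprodDl A B C i j : posop A -> posop B -> posop C ->
  mxprod (fun i j => A i j + B i j) C i j = mxprod A C i j + mxprod B C i j.
Proof.
move=> Ab Bb Cb; apply: EFin_inj; have [[A0 [M AM]] [B0 [N BN]] [C0 _]] := And3 Ab Bb Cb.
have Db : posop (fun i j => A i j + B i j).
  split; first by move=> k l; exact: addr_ge0.
  exists (M + N).
  have := @bounded_by_sum _ _ _ [:: true; false] (fun b => if b then A else B)
    (fun b => if b then M else N).
  rewrite !big_cons big_nil addr0.
  have -> : (fun i k => \sum_(b <- [:: true; false]) (if b then A else B) i k) =
            (fun i k => A i k + B i k).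
    by apply/funext => k; apply/funext => l; rewrite !big_cons big_nil addr0.
  by apply; case.
rewrite [RHS]EFinD !mxprodE// -esumD; first by apply: eq_esum => k _; rewrite mulrDl EFinD.
- by move=> k _; rewrite lee_fin mulr_ge0.
- by move=> k _; rewrite lee_fin mulr_ge0.
Qed.

Lemma posopZ A (c : K) : 0 <= c -> posop A -> posop (fun i j => c * A i j).
Proof.
move=> c0 [A0 [M AM]]; split; first by move=> i j; exact: mulr_ge0.
by exists (c * M); exact: bounded_byZ.
Qed.

Lemma mxprodZl A B (c : K) i j : posop A -> posop B -> 0 <= c ->
  mxprod (fun i j => c * A i j) B i j = c * mxprod A B i j.
Proof.
move=> Ab Bb c0; apply: EFin_inj; have [[A0 _] [B0 _]] := conj Ab Bb.
rewrite EFinM !mxprodE//; last exact: posopZ.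
rewrite -esumZl//; last by move=> k; rewrite lee_fin mulr_ge0.
by apply: eq_esum => k _; rewrite -EFinM mulrA.
Qed.

Lemma mxprodZr A B (c : K) i j : posop A -> posop B -> 0 <= c ->
  mxprod A (fun i j => c * B i j) i j = c * mxprod A B i j.
Proof.
move=> Ab Bb c0; apply: EFin_inj; have [[A0 _] [B0 _]] := conj Ab Bb.
rewrite EFinM !mxprodE//; last exact: posopZ.
rewrite -esumZl//; last by move=> k; rewrite lee_fin mulr_ge0.
by apply: eq_esum => k _; rewrite -EFinM mulrCA.
Qed.

(** Multiplying I + A R <= mu R repeatedly by A gives A^n <= mu^(n+1) R entrywise, so one bounded R
    controls all powers. *)
Lemma growth_supersolution A R (mu : K) : posop A -> posop R -> 0 < mu ->
  (forall i j, mxid K (I:=I) i j + mxprod A R i j <= mu * R i j) -> growth A mu.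
Proof.
move=> Ab Rb mu0 h; have [[A0 _] [R0 [M RM]]] := conj Ab Rb.
have AR0 := mxprod_ge0 A0 R0.
have le n i j : mxpow A n i j <= mu ^+ n.+1 * R i j.
  elim: n i j => [|n ih] i j.
    by rewrite expr1; apply: le_trans (h i j); rewrite lerDl.
  have mun0 : 0 <= mu ^+ n.+1 by rewrite exprn_ge0// ltW.
  rewrite /mxpow iterS -/(mxpow _ _).
  apply: (@le_trans _ _ (mxprod A (fun i j => mu ^+ n.+1 * R i j) i j)).
    by apply: mxprod_le => //; [exact: posop_pow|exact: posopZ].
  rewrite mxprodZr// [mu ^+ n.+2]exprSr -mulrA ler_wpM2l//.
  by apply: le_trans (h i j); rewrite lerDr nonneg_id.
apply: (@growth_intro _ _ _ _ (mu * M)) => [|n]; first exact: ltW.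
apply: bounded_by_le (le n) _; rewrite mulrAC -exprS.
by apply: bounded_byZ => //; rewrite exprn_ge0// ltW.
Qed.

Section Neumann.
Variables (A : imatrix K I) (lam C c : K).
Hypotheses (Ab : posop A) (lam_ge0 : 0 <= lam) (C_ge0 : 0 <= C) (c_ge0 : 0 <= c).
Hypotheses (c_lam : c * lam < 1).
Hypothesis (AC : forall n, bounded_by (mxpow A n) (C * lam ^+ n)).

(** This is (1 - c A)^-1, hence c times it is the resolvent of A at 1 / c. Non-negative terms allow
    an entrywise definition. *)
Definition neumann : imatrix K I := fun i j =>
  fine (esumT (fun n : nat => (c ^+ n * mxpow A n i j)%:E)).

Let M := C / (1 - c * lam).

Let pow0 n : nonneg (mxpow A n). Proof. by case: (posop_pow n Ab). Qed.

Let term_ge0 n i j : 0 <= c ^+ n * mxpow A n i j.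
Proof. by rewrite mulr_ge0 ?exprn_ge0//; exact: pow0. Qed.

Let sumC : (esumT (fun n : nat => (c ^+ n)%:E * (C * lam ^+ n)%:E) <= M%:E)%E.
Proof.
have q01 : 0 <= c * lam < 1 by rewrite mulr_ge0.
rewrite /M EFinM; apply: (@le_trans _ _ (C%:E * esumT (fun n => ((c * lam) ^+ n)%:E))%E).
  rewrite -esumZl//; last by move=> n; rewrite lee_fin exprn_ge0// mulr_ge0.
  by apply: le_esum => n _; rewrite -!EFinM lee_fin exprMn mulrCA.
by apply: lee_wpmul2l; rewrite ?lee_fin//; exact: geometric_esum.
Qed.

Lemma neumannE i j :
  (neumann i j)%:E = esumT (fun n : nat => (c ^+ n * mxpow A n i j)%:E).
Proof.
apply: (@EFin_fine_le _ _ M); first by apply: esum_ge0 => n _; rewrite lee_fin term_ge0.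
apply: le_trans sumC; apply: le_esum => n _.
by rewrite -EFinM lee_fin ler_wpM2l ?exprn_ge0// entry_le.
Qed.

Lemma neumann_ge0 : nonneg neumann.
Proof. by move=> i j; rewrite fine_ge0// esum_ge0// => n _; rewrite lee_fin term_ge0. Qed.

Lemma eact_neumann u i : vnonneg u ->
  eact neumann u i = esumT (fun n : nat => (c ^+ n)%:E * eact (mxpow A n) u i)%E.
Proof.
move=> u0; rewrite /eact.
transitivity (esumT (fun j => esumT (fun n : nat => (c ^+ n * (mxpow A n i j * u j))%:E))).
  apply: eq_esum => j _; rewrite EFinM neumannE muleC -esumZl//.
    by apply: eq_esum => n _; rewrite -EFinM; congr _%:E; ring.
  by move=> n; rewrite lee_fin term_ge0.
rewrite esum_swap; last by move=> j n; rewrite lee_fin !mulr_ge0 ?exprn_ge0//; exact: pow0.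
apply: eq_esum => n _; rewrite -esumZl ?exprn_ge0//.
by move=> j; rewrite lee_fin mulr_ge0//; exact: pow0.
Qed.

Lemma bounded_by_neumann : bounded_by neumann M.
Proof.
move=> x y x0 y0 x1 y1; rewrite bilinE//; last exact: neumann_ge0.
apply: le_trans sumC.
rewrite [leLHS](_ : _ = esumT (fun n : nat => (c ^+ n)%:E * bilin (mxpow A n) x y)%E).
  apply: le_esum => n _; apply: lee_wpmul2l; first by rewrite lee_fin exprn_ge0.
  exact: AC.
transitivity (esumT (fun i => esumT (fun n : nat =>
    ((c ^+ n)%:E * ((x i)%:E * eact (mxpow A n) y i))%E))).
  apply: eq_esum => i _; rewrite eact_neumann// -esumZl//.
    by apply: eq_esum => n _; rewrite muleCA.
  by move=> n; rewrite mule_ge0 ?eact_ge0// lee_fin exprn_ge0.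
rewrite esum_swap; last first.
  by move=> i n; rewrite !mule_ge0 ?eact_ge0// lee_fin ?exprn_ge0.
apply: eq_esum => n _; rewrite bilinE// -esumZl ?exprn_ge0//.
by move=> i; rewrite !mule_ge0 ?eact_ge0// lee_fin.
Qed.

Lemma posop_neumann : posop neumann.
Proof. by split; [exact: neumann_ge0|exists M; exact: bounded_by_neumann]. Qed.

Lemma neumann_eq i j :
  neumann i j = mxid K (I:=I) i j + c * mxprod A neumann i j.
Proof.
apply: EFin_inj; have Nb := posop_neumann.
rewrite EFinD EFinM mxprodE// neumannE esum_nat_recl; last by move=> n; rewrite lee_fin term_ge0.
rewrite expr0 mul1r; congr (_ + _)%E.
have [A0 _] := Ab.
transitivity (c%:E * esumT (fun n : nat => esumT (fun k =>
    (c ^+ n * (A i k * mxpow A n k j))%:E)))%E.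
  rewrite -esumZl//; last first.
    by move=> n; apply: esum_ge0 => k _; rewrite lee_fin !mulr_ge0 ?exprn_ge0//; exact: pow0.
  apply: eq_esum => n _; rewrite exprS -mulrA EFinM; congr (_ * _)%E.
  rewrite /mxpow iterS -/(mxpow _ _) EFinM mxprodE//; last exact: posop_pow.
  rewrite -esumZl ?exprn_ge0//; last by move=> k; rewrite lee_fin mulr_ge0//; exact: pow0.
rewrite esum_swap; last by move=> n k; rewrite lee_fin !mulr_ge0 ?exprn_ge0//; exact: pow0.
congr (_ * _)%E; apply: eq_esum => k _; rewrite EFinM neumannE -esumZl//.
  by apply: eq_esum => n _; rewrite -EFinM; congr _%:E; ring.
by move=> n; rewrite lee_fin term_ge0.
Qed.

End Neumann.

(* A positive resolvent R = (lam - A)^-1 with eps ||R|| < 1 yields the positive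
   resolvent R (1 - eps R)^-1 at the smaller point lam - eps. *)
Lemma growth_resolvent_shift A R (lam eps M : K) : posop A -> nonneg R ->
  bounded_by R M -> 0 <= eps -> eps * M < 1 -> eps < lam ->
  (forall i j, lam * R i j = mxid K (I:=I) i j + mxprod A R i j) ->
  growth A (lam - eps).
Proof.
move=> Ab R0 RM e0 eM el RE; have Rb : posop R by split => //; exists M.
have l0 : 0 <= lam by exact: le_trans e0 (ltW el).
have M0 := bounded_by_ge0 RM.
have [C C0 hC] := growth_bounded_by R0 RM.
pose N := neumann R eps.
have Nb : posop N by exact: (posop_neumann Rb M0 (ltW C0) e0 eM hC).
have NE i j : N i j = mxid K (I:=I) i j + eps * mxprod R N i j.
  exact: (neumann_eq Rb M0 (ltW C0) e0 eM hC).
have RNb := posop_prod Rb Nb.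
(* The supersolution condition holds with equality: lam R N = N + A R N, and N = I + eps R N. *)
apply: (@growth_supersolution _ (mxprod R N)) => // [|i j]; first by rewrite subr_gt0.
have e1 : lam * mxprod R N i j = N i j + mxprod A (mxprod R N) i j.
  rewrite -mxprodZl//.
  rewrite (_ : (fun i j => lam * R i j) =
               (fun i j => mxid K (I:=I) i j + mxprod A R i j)); last first.
    by apply/funext => k; apply/funext => l.
  rewrite mxprodDl//; [|exact: posop_id|exact: posop_prod].
  by have [N0 _] := Nb; rewrite mxprod1l// mxprodA.
rewrite le_eqVlt; apply/orP; left; apply/eqP.
by rewrite mulrBl e1 {1}NE; ring.
Qed.

End MatrixLinearity.

(** * Absolutely convergent sums *)

Section RealSums.
Variable K : realType.

Definition rsummable (J : choiceType) (f : J -> K) : Prop :=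
  (esumT (fun i => `|f i|%:E) < +oo)%E.

Definition pospart (J : choiceType) (f : J -> K) i := Num.max (f i) 0.
Definition negpart (J : choiceType) (f : J -> K) i := Num.max (- f i) 0.

Lemma pospart_ge0 (J : choiceType) (f : J -> K) i : 0 <= pospart f i.
Proof. by rewrite /pospart le_max lexx orbT. Qed.

Lemma negpart_ge0 (J : choiceType) (f : J -> K) i : 0 <= negpart f i.
Proof. by rewrite /negpart le_max lexx orbT. Qed.

Lemma posnegE (J : choiceType) (f : J -> K) i : f i = pospart f i - negpart f i.
Proof.
rewrite /pospart /negpart; case/orP: (le_total 0 (f i)) => f0.
  by rewrite (max_l f0) max_r ?oppr_le0// subr0.
by rewrite (max_r f0) max_l ?oppr_ge0// sub0r opprK.
Qed.

Lemma pospart_le (J : choiceType) (f : J -> K) i : pospart f i <= `|f i|.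
Proof. by rewrite /pospart ge_max normr_ge0 ler_norm. Qed.

Lemma negpart_le (J : choiceType) (f : J -> K) i : negpart f i <= `|f i|.
Proof. by rewrite /negpart ge_max normr_ge0 -normrN ler_norm. Qed.

Lemma esum_lty_le (J : choiceType) (f g : J -> \bar K) : (forall i, f i <= g i)%E ->
  (esumT g < +oo)%E -> (esumT f < +oo)%E.
Proof. by move=> fg; apply: le_lt_trans; apply: le_esum. Qed.

Lemma esum_fineK (J : choiceType) (f : J -> K) : (forall i, 0 <= f i) ->
  (esumT (fun i => (f i)%:E) < +oo)%E ->
  (fine (esumT (fun i => (f i)%:E)))%:E = esumT (fun i => (f i)%:E).
Proof.
by move=> f0 foo; rewrite fineK// ge0_fin_numE// esum_ge0// => i _; rewrite lee_fin.
Qed.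

(** Any splitting into summable non-negative families gives the same value as the canonical one;
    linearity follows, since the parts of a sum are not the sums of the parts. *)
Lemma rsum_diff (J : choiceType) (f g h : J -> K) : (forall i, f i = g i - h i) ->
  (forall i, 0 <= g i) -> (forall i, 0 <= h i) ->
  (esumT (fun i => (g i)%:E) < +oo)%E -> (esumT (fun i => (h i)%:E) < +oo)%E ->
  rsum f = fine (esumT (fun i => (g i)%:E)) - fine (esumT (fun i => (h i)%:E)).
Proof.
move=> fE g0 h0 goo hoo.
have poo : (esumT (fun i => (pospart f i)%:E) < +oo)%E.
  apply: esum_lty_le goo => i; rewrite lee_fin /pospart ge_max g0 andbT fE.
  by rewrite gerBl.
have noo : (esumT (fun i => (negpart f i)%:E) < +oo)%E.
  apply: esum_lty_le hoo => i; rewrite lee_fin /negpart ge_max h0 andbT fE opprB.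
  by rewrite gerBl.
rewrite /rsum; apply/eqP; rewrite subr_eq addrAC eq_sym subr_eq; apply/eqP/EFin_inj.
rewrite !EFinD !esum_fineK//; [|exact: pospart_ge0|exact: negpart_ge0].
rewrite -!esumD; try by move=> i _; rewrite lee_fin ?pospart_ge0 ?negpart_ge0.
apply: eq_esum => i _; rewrite -!EFinD; congr _%:E.
by have := posnegE f i; rewrite /pospart /negpart fE; lra.
Qed.

Lemma rsum_posneg (J : choiceType) (f : J -> K) : rsummable f ->
  [/\ (esumT (fun i => (pospart f i)%:E) < +oo)%E,
      (esumT (fun i => (negpart f i)%:E) < +oo)%E &
      rsum f = fine (esumT (fun i => (pospart f i)%:E)) -
               fine (esumT (fun i => (negpart f i)%:E))].
Proof.
move=> fs; split => //; apply: esum_lty_le fs => i; rewrite lee_fin.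
  exact: pospart_le.
exact: negpart_le.
Qed.

Lemma esumD_lty (J : choiceType) (f g : J -> K) : (forall i, 0 <= f i) ->
  (forall i, 0 <= g i) -> (esumT (fun i => (f i)%:E) < +oo)%E ->
  (esumT (fun i => (g i)%:E) < +oo)%E ->
  (esumT (fun i => (f i + g i)%:E) < +oo)%E /\
  fine (esumT (fun i => (f i + g i)%:E)) =
  fine (esumT (fun i => (f i)%:E)) + fine (esumT (fun i => (g i)%:E)).
Proof.
move=> f0 g0 foo goo.
have E : esumT (fun i => (f i + g i)%:E) =
    (esumT (fun i => (f i)%:E) + esumT (fun i => (g i)%:E))%E.
  rewrite -esumD; [by apply: eq_esum => i _; rewrite EFinD| |].
    by move=> i _; rewrite lee_fin.
  by move=> i _; rewrite lee_fin.
rewrite E; split; first exact: lte_add_pinfty.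
apply: EFin_inj; rewrite EFinD !esum_fineK// -(esum_fineK f0 foo) -(esum_fineK g0 goo).
by rewrite -EFinD.
Qed.

Lemma rsumD (J : choiceType) (f g : J -> K) : rsummable f -> rsummable g ->
  rsum (fun i => f i + g i) = rsum f + rsum g.
Proof.
move=> /rsum_posneg[fp fn fE] /rsum_posneg[gp gn gE].
have [poo pE] := esumD_lty (pospart_ge0 f) (pospart_ge0 g) fp gp.
have [noo nE] := esumD_lty (negpart_ge0 f) (negpart_ge0 g) fn gn.
rewrite (@rsum_diff _ _ (fun i => pospart f i + pospart g i)
  (fun i => negpart f i + negpart g i))//.
- by rewrite pE nE fE gE; lra.
- by move=> i; rewrite (posnegE f i) (posnegE g i); lra.
- by move=> i; rewrite addr_ge0 ?pospart_ge0.
- by move=> i; rewrite addr_ge0 ?negpart_ge0.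
Qed.

Lemma rsumN (J : choiceType) (f : J -> K) : rsum (fun i => - f i) = - rsum f.
Proof.
rewrite /rsum opprB; congr (_ - _); congr fine; apply: eq_esum => i _.
by rewrite opprK.
Qed.

Lemma esumZ_lty (J : choiceType) (c : K) (f : J -> K) : 0 <= c ->
  (forall i, 0 <= f i) -> (esumT (fun i => (f i)%:E) < +oo)%E ->
  (esumT (fun i => (c * f i)%:E) < +oo)%E /\
  fine (esumT (fun i => (c * f i)%:E)) = c * fine (esumT (fun i => (f i)%:E)).
Proof.
move=> c0 f0 foo.
have E : esumT (fun i => (c * f i)%:E) = (c%:E * esumT (fun i => (f i)%:E))%E.
  by rewrite -esumZl//.
by rewrite E -(esum_fineK f0 foo) -EFinM ltry.
Qed.

Lemma rsumZ (J : choiceType) (c : K) (f : J -> K) : rsummable f ->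
  rsum (fun i => c * f i) = c * rsum f.
Proof.
wlog c0 : c / 0 <= c => [hw fs|/rsum_posneg[fp fn fE]].
  have [c0|c0] := leP 0 c; first exact: hw.
  rewrite -[c]opprK mulNr -hw// ?oppr_ge0 ?ltW// -rsumN.
  by congr rsum; apply/funext => i; rewrite mulNr.
have [poo pE] := esumZ_lty c0 (pospart_ge0 f) fp.
have [noo nE] := esumZ_lty c0 (negpart_ge0 f) fn.
rewrite (@rsum_diff _ _ (fun i => c * pospart f i) (fun i => c * negpart f i))//.
- by rewrite pE nE fE; lra.
- by move=> i; rewrite -mulrBr -posnegE.
- by move=> i; rewrite mulr_ge0 ?pospart_ge0.
- by move=> i; rewrite mulr_ge0 ?negpart_ge0.
Qed.

Lemma rsummableZ (J : choiceType) (c : K) (f : J -> K) : rsummable f ->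
  rsummable (fun i => c * f i).
Proof.
move=> fs; have [h _] := esumZ_lty (normr_ge0 c) (fun i => normr_ge0 (f i)) fs.
by apply: esum_lty_le h => i; rewrite normrM.
Qed.

Lemma rsum_le (J : choiceType) (f g : J -> K) : (forall i, 0 <= g i) ->
  (forall i, f i <= g i) -> ((rsum f)%:E <= esumT (fun i => (g i)%:E))%E.
Proof.
move=> g0 fg; have [->|goo] := eqVneq (esumT (fun i => (g i)%:E)) +oo%E.
  by rewrite leey.
have {}goo : (esumT (fun i => (g i)%:E) < +oo)%E by rewrite ltey.
rewrite -(esum_fineK g0 goo) lee_fin.
apply: (@le_trans _ _ (fine (esumT (fun i => (pospart f i)%:E)))).
  rewrite /rsum gerBl fine_ge0// esum_ge0// => i _; rewrite lee_fin.
  exact: negpart_ge0.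
have pg : (esumT (fun i => (pospart f i)%:E) <= esumT (fun i => (g i)%:E))%E.
  by apply: le_esum => i _; rewrite lee_fin /pospart ge_max g0 fg.
rewrite fine_le// ?ge0_fin_numE//.
- by apply: le_lt_trans goo.
- by apply: esum_ge0 => i _; rewrite lee_fin pospart_ge0.
- by apply: esum_ge0 => i _; rewrite lee_fin.
Qed.

Lemma rsum_rsum (I J : choiceType) (f : I -> J -> K) :
  (esumT (fun i => esumT (fun j => `|f i j|%:E)) < +oo)%E ->
  rsum (fun i => rsum (f i)) =
  fine (esumT (fun i => esumT (fun j => (pospart (f i) j)%:E))) -
  fine (esumT (fun i => esumT (fun j => (negpart (f i) j)%:E))).
Proof.
move=> foo.
have row i : rsummable (f i).
  apply: le_lt_trans foo.
  apply: (@ge_esum1 _ _ (fun i => esumT (fun j => `|f i j|%:E))) => k.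
  by apply: esum_ge0.
have part_oo (p : (J -> K) -> J -> K) : (forall g j, 0 <= p g j) ->
    (forall g j, p g j <= `|g j|) ->
    (forall i, (esumT (fun j => (p (f i) j)%:E) < +oo)%E) /\
    (esumT (fun i => esumT (fun j => (p (f i) j)%:E)) < +oo)%E.
  move=> p0 pf; split => [i|].
    by apply: esum_lty_le (row i) => j; rewrite lee_fin.
  by apply: esum_lty_le foo => i; apply: le_esum => j _; rewrite lee_fin.
have [prow poo] := part_oo _ (@pospart_ge0 J) (@pospart_le J).
have [nrow noo] := part_oo _ (@negpart_ge0 J) (@negpart_le J).
have pE i := esum_fineK (pospart_ge0 (f i)) (prow i).
have nE i := esum_fineK (negpart_ge0 (f i)) (nrow i).
rewrite (@rsum_diff _ _ (fun i => fine (esumT (fun j => (pospart (f i) j)%:E)))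
  (fun i => fine (esumT (fun j => (negpart (f i) j)%:E)))).
- by congr (fine _ - fine _); apply: eq_esum.
- by [].
- by move=> i; rewrite fine_ge0// esum_ge0// => j _; rewrite lee_fin pospart_ge0.
- by move=> i; rewrite fine_ge0// esum_ge0// => j _; rewrite lee_fin negpart_ge0.
- by apply: esum_lty_le poo => i; rewrite pE.
- by apply: esum_lty_le noo => i; rewrite nE.
Qed.

(** Fubini, as Tonelli on the positive and negative parts separately. *)
Lemma rsum_swap (I J : choiceType) (f : I -> J -> K) :
  (esumT (fun i => esumT (fun j => `|f i j|%:E)) < +oo)%E ->
  rsum (fun i => rsum (f i)) = rsum (fun j => rsum (f ^~ j)).
Proof.
move=> foo; rewrite rsum_rsum// rsum_rsum; last by rewrite esum_swap.
congr (fine _ - fine _); rewrite esum_swap//.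
  by move=> i j; rewrite lee_fin pospart_ge0.
by move=> i j; rewrite lee_fin negpart_ge0.
Qed.

Lemma rsum_nat_recl (f : nat -> K) : rsummable f ->
  rsum f = f 0%N + rsum (fun n => f n.+1).
Proof.
have tail (g : nat -> K) : (forall i, 0 <= g i) -> (esumT (fun i => (g i)%:E) < +oo)%E ->
    fine (esumT (fun i => (g i)%:E)) = g 0%N + fine (esumT (fun i => (g i.+1)%:E)).
  move=> g0 goo; have gS0 i : (0 <= (g i.+1)%:E)%E by rewrite lee_fin.
  have E : esumT (fun i => (g i)%:E) = ((g 0%N)%:E + esumT (fun i => (g i.+1)%:E))%E.
    by apply: esum_nat_recl => i; rewrite lee_fin.
  have Soo : (esumT (fun i => (g i.+1)%:E) < +oo)%E.
    by apply: le_lt_trans goo; rewrite E leeDr// lee_fin.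
  by rewrite E -(esum_fineK (f := fun i => g i.+1)).
move=> fs; have [fp fn ->] := rsum_posneg fs.
rewrite (tail _ (pospart_ge0 f) fp) (tail _ (negpart_ge0 f) fn).
have -> : rsum (fun n => f n.+1) = fine (esumT (fun n => (pospart f n.+1)%:E)) -
    fine (esumT (fun n => (negpart f n.+1)%:E)) by [].
by have := posnegE f 0%N; lra.
Qed.

End RealSums.

(** * Absolutely convergent complex sums *)

Section ComplexSums.
Import Normc.
Local Open Scope complex_scope.
Variable K : realType.

Lemma normc_ge0 (z : K[i]) : 0 <= normc z.
Proof. by case: z => a b; exact: sqrtr_ge0. Qed.

Lemma normr_Re_le (z : K[i]) : `|complex.Re z| <= normc z.
Proof.
case: z => a b /=; rewrite -sqrtr_sqr ler_wsqrtr// lerDl.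
exact: sqr_ge0.
Qed.

Lemma normr_Im_le (z : K[i]) : `|complex.Im z| <= normc z.
Proof.
case: z => a b /=; rewrite -sqrtr_sqr ler_wsqrtr// lerDr.
exact: sqr_ge0.
Qed.

Lemma csummableE (J : choiceType) (x : J -> K[i]) :
  csummable x <-> (esumT (fun i => (normc (x i))%:E) < +oo)%E.
Proof.
rewrite /csummable /summable.
by under eq_esum do rewrite abse_EFin ger0_norm ?normc_ge0//.
Qed.

Lemma csummable_Re (J : choiceType) (x : J -> K[i]) : csummable x ->
  rsummable (fun i => complex.Re (x i)).
Proof.
move=> /csummableE; apply: esum_lty_le => i; rewrite lee_fin.
exact: normr_Re_le.
Qed.

Lemma csummable_Im (J : choiceType) (x : J -> K[i]) : csummable x ->
  rsummable (fun i => complex.Im (x i)).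
Proof.
move=> /csummableE; apply: esum_lty_le => i; rewrite lee_fin.
exact: normr_Im_le.
Qed.

Lemma complex_ext (z w : K[i]) : complex.Re z = complex.Re w ->
  complex.Im z = complex.Im w -> z = w.
Proof. by case: z => a b; case: w => c d /= -> ->. Qed.

Lemma csumD (J : choiceType) (x y : J -> K[i]) : csummable x -> csummable y ->
  csum (fun i => x i + y i) = csum x + csum y.
Proof.
move=> xs ys; apply: complex_ext => /=.
  rewrite -rsumD; [|exact: csummable_Re..].
  by congr rsum; apply/funext => i; case: (x i) => a b; case: (y i).
rewrite -rsumD; [|exact: csummable_Im..].
by congr rsum; apply/funext => i; case: (x i) => a b; case: (y i).
Qed.

Lemma csumZ (J : choiceType) (c : K[i]) (x : J -> K[i]) : csummable x ->
  csum (fun i => c * x i) = c * csum x.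
Proof.
move=> xs; have [Rs Is] := (csummable_Re xs, csummable_Im xs).
case: c => c d; apply: complex_ext => /=.
  have dIs : rsummable (fun i => - (d * complex.Im (x i))).
    have := rsummableZ (- d) Is; congr rsummable.
    by apply/funext => i; rewrite mulNr.
  rewrite -!rsumZ// -rsumN -rsumD//; last exact: rsummableZ.
  by congr rsum; apply/funext => i; case: (x i).
rewrite -!rsumZ// -rsumD; [|exact: rsummableZ..].
by congr rsum; apply/funext => i; case: (x i).
Qed.

Lemma normc_csum_le (J : choiceType) (x : J -> K[i]) :
  csummable x -> ((normc (csum x))%:E <= esumT (fun i => (normc (x i))%:E))%E.
Proof.
move=> xs; have [Rs Is] := (csummable_Re xs, csummable_Im xs).
set n := normc (csum x); have := normc_ge0 (csum x).
rewrite -/n le_eqVlt => /predU1P[<-|n0].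
  by apply: esum_ge0 => i _; rewrite lee_fin normc_ge0.
set a := rsum (fun i => complex.Re (x i)); set b := rsum (fun i => complex.Im (x i)).
have nE : n * n = a * a + b * b.
  by rewrite -!expr2 sqr_sqrtr// addr_ge0 ?sqr_ge0.
rewrite -(@lee_pmul2l _ n%:E) ?lte_fin// -EFinM nE -esumZl ?(ltW n0)//; last first.
  by move=> i; rewrite lee_fin normc_ge0.
rewrite -!rsumZ// -rsumD; [|exact: rsummableZ..].
under [leRHS]eq_esum do rewrite -EFinM.
apply: rsum_le => i; first by rewrite mulr_ge0 ?normc_ge0// ltW.
case: (x i) => u v.
(* Multiplying by the conjugate a - ib of the total makes the sum real: n^2 is the sum of the real
   parts of these products, each at most its modulus. *)
have -> : n * normc (u +i* v) = normc ((a -i* b) * (u +i* v)).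
  by rewrite normcM /n /= sqrrN.
apply: le_trans (normr_Re_le _).
by rewrite /= mulNr opprK ler_norm.
Qed.

Lemma csum_swap (I J : choiceType) (x : I -> J -> K[i]) :
  (esumT (fun i => esumT (fun j => (normc (x i j))%:E)) < +oo)%E ->
  csum (fun i => csum (x i)) = csum (fun j => csum (x ^~ j)).
Proof.
move=> xoo; apply: complex_ext => /=; apply: rsum_swap.
  apply: esum_lty_le xoo => i; apply: le_esum => j _.
  by rewrite lee_fin normr_Re_le.
apply: esum_lty_le xoo => i; apply: le_esum => j _.
by rewrite lee_fin normr_Im_le.
Qed.

Lemma csum_nat_recl (x : nat -> K[i]) : csummable x ->
  csum x = x 0%N + csum (fun n => x n.+1).
Proof.
move=> xs; rewrite /csum rsum_nat_recl; last exact: csummable_Re.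
rewrite (rsum_nat_recl (csummable_Im xs)).
by case: (x 0%N).
Qed.

Lemma csum_real (J : choiceType) (f : J -> K) : (forall i, 0 <= f i) ->
  csum (fun i => (f i)%:C) = (fine (esumT (fun i => (f i)%:E)))%:C.
Proof.
move=> f0; rewrite /csum /= !rsum_ge0E//.
by rewrite (esum0 K J).
Qed.

End ComplexSums.

(** * Operators and resolvents *)

Section Operators.
Import Normc.
Local Open Scope complex_scope.
Variables (K : realType) (I : choiceType).
Implicit Types (A B : imatrix K I) (x y : I -> K[i]) (u v : I -> K).

Definition vabs x : I -> K := fun i => normc (x i).

Lemma vabs_ge0 x : vnonneg (vabs x).
Proof. by move=> i; exact: normc_ge0. Qed.

Lemma normc_real (r : K) : normc (r%:C) = `|r|.
Proof. by rewrite /= expr0n addr0 sqrtr_sqr. Qed.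

Lemma l2E x : l2 x <-> (sqnorm (vabs x) < +oo)%E.
Proof.
rewrite /l2 /summable /sqnorm.
by under eq_esum do rewrite abse_EFin ger0_norm ?sqr_ge0//.
Qed.

Lemma l2_lty x : l2 x -> (sqnorm (vabs x) < +oo)%E.
Proof. by case: (l2E x) => h _; exact: h. Qed.

Lemma l2_le x v : (forall i, vabs x i <= v i) -> (sqnorm v < +oo)%E -> l2 x.
Proof.
move=> xv voo; apply: (l2E _).2; apply: le_lt_trans voo.
by apply: sqnorm_le => //; exact: vabs_ge0.
Qed.

Lemma l2_real v : vnonneg v -> (sqnorm v < +oo)%E -> l2 (fun i => (v i)%:C).
Proof. by move=> v0; apply: l2_le => i; rewrite /vabs normc_real ger0_norm. Qed.

Lemma csummableZ (J : choiceType) (c : K[i]) (x : J -> K[i]) : csummable x ->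
  csummable (fun i => c * x i).
Proof.
move=> /csummableE xs; apply/csummableE.
have [h _] := esumZ_lty (normc_ge0 c) (fun i => normc_ge0 (x i)) xs.
by apply: esum_lty_le h => i; rewrite normcM.
Qed.

(** From (p + q)^2 <= 2 p^2 + 2 q^2; the factor 2 is harmless both for closure of l2 and for the
    resolvent estimate in [growth_below]. *)
Lemma sqnorm_vabsD (a b : K[i]) x y :
  (sqnorm (vabs (fun i => (a * x i + b * y i)%R)) <=
   ((2 * normc a ^+ 2)%R)%:E * sqnorm (vabs x) +
   ((2 * normc b ^+ 2)%R)%:E * sqnorm (vabs y))%E.
Proof.
have sq0 (z : I -> K) i : (0 <= (z i ^+ 2)%:E)%E by rewrite lee_fin sqr_ge0.
have c0 (c : K[i]) : 0 <= 2 * normc c ^+ 2 by rewrite mulr_ge0 ?sqr_ge0.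
rewrite /sqnorm -!esumZl// -esumD; last 2 first.
- by move=> i _; rewrite mule_ge0// lee_fin.
- by move=> i _; rewrite mule_ge0// lee_fin.
apply: le_esum => i _; rewrite -!EFinM -EFinD lee_fin /vabs.
apply: (@le_trans _ _ ((normc a * normc (x i) + normc b * normc (y i)) ^+ 2)).
  rewrite ler_sqr ?nnegrE ?addr_ge0 ?mulr_ge0 ?normc_ge0//.
  by rewrite -!normcM le_normcD.
rewrite -subr_ge0.
have -> : 2 * normc a ^+ 2 * normc (x i) ^+ 2 + 2 * normc b ^+ 2 * normc (y i) ^+ 2 -
    (normc a * normc (x i) + normc b * normc (y i)) ^+ 2 =
    (normc a * normc (x i) - normc b * normc (y i)) ^+ 2 by ring.
exact: sqr_ge0.
Qed.

Lemma l2_lin (a : K[i]) x y : l2 x -> l2 y -> l2 (fun i => a * x i + y i).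
Proof.
move=> /l2_lty xs /l2_lty ys; apply: (l2E _).2.
have -> : (fun i => a * x i + y i) = (fun i => a * x i + 1 * y i).
  by apply/funext => i; rewrite mul1r.
apply: le_lt_trans (sqnorm_vabsD _ _ _ _) _; apply: lte_add_pinfty.
  by apply: lte_mul_pinfty => //; rewrite lee_fin mulr_ge0 ?sqr_ge0.
by apply: lte_mul_pinfty => //; rewrite lee_fin mulr_ge0 ?sqr_ge0.
Qed.

Lemma normc_term A x i j : nonneg A -> normc ((A i j)%:C * x j) = A i j * vabs x j.
Proof. by move=> A0; rewrite normcM normc_real ger0_norm. Qed.

Lemma mxact_csummable A x i : posop A -> l2 x ->
  csummable (fun j => (A i j)%:C * x j).
Proof.
move=> [A0 [M AM]] /l2_lty xs; apply/csummableE.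
have := ractE i A0 AM (vabs_ge0 x) xs; rewrite /eact.
by under eq_esum do rewrite -normc_term//; move=> <-; rewrite ltry.
Qed.

Lemma mxact_le A x i : posop A -> l2 x -> vabs (mxact A x) i <= ract A (vabs x) i.
Proof.
move=> Ab xs; have [A0 [M AM]] := Ab.
rewrite -lee_fin (ractE i A0 AM (vabs_ge0 x)); last exact: l2_lty.
apply: le_trans (normc_csum_le (mxact_csummable i Ab xs)) _.
by apply: le_esum => j _; rewrite normc_term.
Qed.

Lemma sqnorm_ract_lty A v : posop A -> vnonneg v -> (sqnorm v < +oo)%E ->
  (sqnorm (ract A v) < +oo)%E.
Proof.
move=> [A0 [M AM]] v0 /sqnormP[b b0 vb].
by apply: sqnorm_lty; exact: sqnorm_ract A0 AM v0 b0 vb.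
Qed.

Lemma l2_mxact A x : posop A -> l2 x -> l2 (mxact A x).
Proof.
move=> Ab xs; apply: (@l2_le _ (ract A (vabs x))) => [i|]; first exact: mxact_le.
by apply: sqnorm_ract_lty => //; [exact: vabs_ge0|exact: l2_lty].
Qed.

Lemma posop_defines_operator A : posop A -> defines_operator A.
Proof.
by move=> Ab x xs; split; [move=> i; exact: mxact_csummable|exact: l2_mxact].
Qed.

Lemma l2norm_le x (b : K) : 0 <= b -> (sqnorm (vabs x) <= (b ^+ 2)%:E)%E ->
  l2norm x <= b.
Proof.
move=> b0 xb; rewrite /l2norm -/(vabs x) -[leRHS]ger0_norm// -sqrtr_sqr.
by rewrite ler_wsqrtr// (fine_le_real _ xb)// sqnorm_ge0.
Qed.

Lemma sqnorm_l2norm x : l2 x -> sqnorm (vabs x) = (l2norm x ^+ 2)%:E.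
Proof.
move=> /l2_lty xs; rewrite /l2norm sqr_sqrtr; last first.
  by apply: fine_ge0; exact: sqnorm_ge0.
by rewrite fineK// ge0_fin_numE// sqnorm_ge0.
Qed.

Lemma opnorm_le A M : nonneg A -> bounded_by A M -> 0 <= opnorm A <= M.
Proof.
move=> A0 AM; have Ab : posop A by split => //; exists M.
have ubM : ubound [set l2norm (mxact A x) | x in [set x | l2 x /\ l2norm x <= 1]] M.
  move=> _ [x [xs x1] <-]; have M0 := bounded_by_ge0 AM.
  apply: l2norm_le => //; have xs1 : (sqnorm (vabs x) <= (1 ^+ 2)%:E)%E.
    by rewrite sqnorm_l2norm// lee_fin ler_sqr ?nnegrE ?sqrtr_ge0.
  have := sqnorm_ract A0 AM (vabs_ge0 x) ler01 xs1; rewrite mulr1.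
  apply: le_trans; apply: sqnorm_le => [|i]; first exact: vabs_ge0.
  exact: mxact_le.
have z2 : l2 (fun _ : I => 0 : K[i]).
  by apply: (l2E _).2; rewrite /sqnorm esum1// => i _; rewrite /vabs normc0 expr0n.
(* The zero vector makes the set nonempty, so that [sup] is a true supremum and is at least 0. *)
have zin : [set l2norm (mxact A x) | x in [set x | l2 x /\ l2norm x <= 1]]
    (l2norm (mxact A (fun=> 0))).
  exists (fun=> 0) => //; split=> //; apply: l2norm_le => //.
  by rewrite /sqnorm esum1// => i _; rewrite /vabs normc0 expr0n.
apply/andP; split; last by apply: ge_sup => //; eexists; exact: zin.
apply: le_trans (sqrtr_ge0 _ : 0 <= l2norm (mxact A (fun=> 0))) _.
by apply: ub_le_sup => //; exists M.
Qed.

Lemma mxact_lin A (a : K[i]) x y : posop A -> l2 x -> l2 y ->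
  mxact A (fun i => a * x i + y i) = (fun i => a * mxact A x i + mxact A y i).
Proof.
move=> Ab xs ys; apply/funext => i; rewrite /mxact.
rewrite -csumZ; last exact: mxact_csummable.
rewrite -csumD; [|apply: csummableZ; exact: mxact_csummable|exact: mxact_csummable].
by congr csum; apply/funext => j; ring.
Qed.

Lemma l2_iter A n x : posop A -> l2 x -> l2 (iter n (mxact A) x).
Proof. by move=> Ab xs; elim: n => //= n; exact: l2_mxact. Qed.

Lemma iter_mxact_lin A n (a : K[i]) x y : posop A -> l2 x -> l2 y ->
  iter n (mxact A) (fun i => a * x i + y i) =
  (fun i => a * iter n (mxact A) x i + iter n (mxact A) y i).
Proof.
move=> Ab xs ys; elim: n => //= n ->.
by rewrite mxact_lin//; exact: l2_iter.
Qed.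

Lemma eact_le_mono A u v i : nonneg A -> (forall j, u j <= v j) ->
  (eact A u i <= eact A v i)%E.
Proof. by move=> A0 uv; apply: le_esum => j _; rewrite lee_fin ler_wpM2l. Qed.

Lemma iter_mxact_le A n x i : posop A -> l2 x ->
  ((vabs (iter n (mxact A) x) i)%:E <= eact (mxpow A n) (vabs x) i)%E.
Proof.
move=> Ab xs; have xoo : (sqnorm (vabs x) < +oo)%E by exact: l2_lty.
have [A0 [M AM]] := Ab.
elim: n i => [|n ih] i; first by rewrite eact_id//; exact: vabs_ge0.
have Pb := posop_pow n Ab; have [P0 [N PN]] := Pb.
have ns := l2_iter n Ab xs; have nsoo : (sqnorm (vabs (iter n (mxact A) x)) < +oo)%E.
  exact: l2_lty.
rewrite /mxpow !iterS -/(mxpow A n) eact_prod//; last exact: vabs_ge0.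
apply: (@le_trans _ _ (eact A (vabs (iter n (mxact A) x)) i)).
  rewrite -(ractE i A0 AM (vabs_ge0 _))// lee_fin.
  exact: mxact_le.
apply: eact_le_mono => // j; rewrite -lee_fin (ractE j P0 PN)//.
exact: vabs_ge0.
Qed.

Lemma bounded_operator_lin T : (forall (a : K[i]) x y, l2 x -> l2 y ->
    T (fun i => a * x i + y i) = (fun i => a * T x i + T y i)) ->
  forall (a : K[i]) x, l2 x -> T (fun i => a * x i) = (fun i => a * T x i) :> (I -> K[i]).
Proof.
move=> lin a x xs.
(* Linearity is given in the form a x + y; this choice with y = x avoids the value of T at 0. *)
have -> : (fun i => a * x i) = (fun i => (a - 1) * x i + x i).
  by apply/funext => i; ring.
by rewrite lin//; apply/funext => i; ring.
Qed.

(** * The resolvent outside a disc whose radius is a growth rate *)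

Section ResolventSeries.
Variables (A : imatrix K I) (lam : K) (z : K[i]).
Hypotheses (Ab : posop A) (lam_ge0 : 0 <= lam) (Agrow : growth A lam).
Hypothesis (lam_z : lam < normc z).

Definition resolvent_term x i n := z^-1 ^+ n.+1 * iter n (mxact A) x i.

Definition resolvent_series x : I -> K[i] := fun i => csum (resolvent_term x i).

Let c := (normc z)^-1.
Let N := neumann A c.

Let nz_gt0 : 0 < normc z. Proof. exact: le_lt_trans lam_z. Qed.
Let z_neq0 : z != 0.
Proof. by apply/eqP => z0; move: nz_gt0; rewrite z0 normc0 ltxx. Qed.
Let c_ge0 : 0 <= c. Proof. by rewrite invr_ge0 ltW. Qed.
Let c_lam : c * lam < 1. Proof. by rewrite mulrC ltr_pdivrMr// mul1r. Qed.

Let Nb : posop N.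
Proof.
have [C /ltW C0 hC] := Agrow.
exact: posop_neumann Ab lam_ge0 C0 c_ge0 c_lam hC.
Qed.

(** Since |A^n x| <= A^n |x|, the complex series is dominated termwise by the non-negative Neumann
    series at c = 1 / |z|. *)
Lemma resolvent_term_esum x i : l2 x ->
  (esumT (fun n => (normc (resolvent_term x i n))%:E) <= (c * ract N (vabs x) i)%:E)%E.
Proof.
move=> xs; have xoo : (sqnorm (vabs x) < +oo)%E by exact: l2_lty.
have [C /ltW C0 hC] := Agrow; have [N0 [M NM]] := Nb.
have v0 := vabs_ge0 x.
rewrite EFinM (ractE i N0 NM)// (eact_neumann Ab lam_ge0 C0 c_ge0 c_lam hC)//.
rewrite -esumZl//; last first.
  move=> n; rewrite mule_ge0 ?lee_fin ?exprn_ge0//; apply: eact_ge0 => //.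
  by case: (posop_pow n Ab).
apply: le_esum => n _; rewrite muleA -EFinM -exprS normcM EFinM.
have -> : normc (z^-1 ^+ n.+1) = c ^+ n.+1.
  elim: n.+1 => [|k ih]; first by rewrite !expr0 normc1.
  by rewrite !exprS normcM normcV ih.
by apply: lee_wpmul2l; [rewrite lee_fin exprn_ge0|exact: iter_mxact_le].
Qed.

Lemma resolvent_term_csummable x i : l2 x -> csummable (resolvent_term x i).
Proof.
by move=> xs; apply/csummableE; apply: le_lt_trans (resolvent_term_esum i xs) (ltry _).
Qed.

Lemma resolvent_series_le x i : l2 x ->
  vabs (resolvent_series x) i <= c * ract N (vabs x) i.
Proof.
move=> xs; rewrite -lee_fin; apply: le_trans (resolvent_term_esum i xs).
exact: normc_csum_le (resolvent_term_csummable i xs).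
Qed.

(** The common value of A R x and R A x, where R is the resolvent series; z R x exceeds it by x,
    which gives both inverse identities. *)
Let shifted x i := csum (fun n => z^-1 ^+ n.+1 * iter n.+1 (mxact A) x i).

Let z_resolvent x i : l2 x -> z * resolvent_series x i = x i + shifted x i.
Proof.
move=> xs; have ts := resolvent_term_csummable i xs.
have E : (fun n => z * resolvent_term x i n) =
    (fun n => z^-1 ^+ n * iter n (mxact A) x i).
  by apply/funext => n; rewrite /resolvent_term exprS !mulrA divff// mul1r.
rewrite /resolvent_series -csumZ// csum_nat_recl; last exact: csummableZ.
rewrite /resolvent_term/= expr1 mulrA divff// mul1r; congr (_ + csum _).
by apply/funext => n; have := congr1 (@^~ n.+1) E; rewrite /resolvent_term.
Qed.

Let mxact_resolvent x i : l2 x -> mxact A (resolvent_series x) i = shifted x i.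
Proof.
move=> xs; have [A0 [M AM]] := Ab; have [N0 [P NP]] := Nb.
have xoo : (sqnorm (vabs x) < +oo)%E by exact: l2_lty.
have Nx0 : vnonneg (ract N (vabs x)) by apply: ract_ge0 => //; exact: vabs_ge0.
have Nxoo : (sqnorm (ract N (vabs x)) < +oo)%E.
  by apply: sqnorm_ract_lty => //; exact: vabs_ge0.
transitivity (csum (fun k => csum (fun n => (A i k)%:C * resolvent_term x k n))).
  congr csum; apply/funext => k; rewrite csumZ//.
  exact: resolvent_term_csummable.
rewrite csum_swap.
  congr csum; apply/funext => n; rewrite iterS /mxact -csumZ; last first.
    by apply: mxact_csummable => //; exact: l2_iter.
  by congr csum; apply/funext => k; rewrite /resolvent_term mulrCA.
(* Absolute convergence for Fubini: the double sum of moduli is at most c (A N |x|)_i. *)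
apply: (@le_lt_trans _ _ (c%:E * eact A (ract N (vabs x)) i)%E); last first.
  by rewrite -(ractE i A0 AM)// -EFinM ltry.
rewrite -esumZl//; last by move=> k; rewrite lee_fin mulr_ge0.
apply: le_esum => k _.
rewrite (_ : (fun n => _) = (fun n => ((A i k)%:E * (normc (resolvent_term x k n))%:E)%E)).
  rewrite esumZl//; last by move=> n; rewrite lee_fin normc_ge0.
  rewrite [leRHS](_ : _ = ((A i k)%:E * (c * ract N (vabs x) k)%:E)%E).
    by apply: lee_wpmul2l; [rewrite lee_fin|exact: resolvent_term_esum].
  by rewrite -!EFinM mulrCA.
by apply/funext => n; rewrite normcM normc_real ger0_norm// EFinM.
Qed.

Lemma resolvent_series_bounded : bounded_operator resolvent_series.
Proof.
split.
- move=> x xs; apply: (@l2_le _ (fun i => c * ract N (vabs x) i)) => [i|].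
    exact: resolvent_series_le.
  rewrite sqnormZ; apply: lte_mul_pinfty; rewrite ?lee_fin ?sqr_ge0//.
  by apply: sqnorm_ract_lty => //; [exact: vabs_ge0|exact: l2_lty].
- move=> a x y xs ys; apply/funext => i; rewrite /resolvent_series.
  rewrite -csumZ; last exact: resolvent_term_csummable.
  have [xs' ys'] := (resolvent_term_csummable i xs, resolvent_term_csummable i ys).
  rewrite -csumD//; last exact: csummableZ.
  congr csum; apply/funext => n; rewrite /resolvent_term iter_mxact_lin//.
  by ring.
- have [N0 [P NP]] := Nb; have P0 := bounded_by_ge0 NP.
  exists (c * P) => x xs; have b0 : 0 <= l2norm x by exact: sqrtr_ge0.
  apply: l2norm_le; first by rewrite !mulr_ge0.
  apply: (@le_trans _ _ (sqnorm (fun i => c * ract N (vabs x) i))).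
    by apply: sqnorm_le => [|i]; [exact: vabs_ge0|exact: resolvent_series_le].
  have -> : ((c * P * l2norm x) ^+ 2)%:E = ((c ^+ 2)%:E * ((P * l2norm x) ^+ 2)%:E)%E.
    by rewrite -EFinM; congr _%:E; ring.
  rewrite sqnormZ; apply: lee_wpmul2l.
    by rewrite lee_fin sqr_ge0.
  by apply: sqnorm_ract => //; [exact: vabs_ge0|rewrite sqnorm_l2norm].
Qed.

Lemma mem_resolvent_set : resolvent_set A z.
Proof.
exists resolvent_series; first exact: resolvent_series_bounded.
have [_ lin _] := resolvent_series_bounded.
move=> x xs; have Axs := l2_mxact Ab xs; split; apply/funext => i; last first.
  by rewrite /shift_op z_resolvent// mxact_resolvent// addrK.
have zxs : l2 (fun i => z * x i).
  have -> : (fun i => z * x i) = (fun i => (z - 1) * x i + x i).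
    by apply/funext => j; ring.
  exact: l2_lin.
have -> : shift_op z A x = (fun i => -1 * mxact A x i + z * x i).
  by apply/funext => j; rewrite /shift_op; ring.
rewrite lin// (bounded_operator_lin lin)// z_resolvent//.
have -> : resolvent_series (mxact A x) i = shifted x i.
  by congr csum; apply/funext => n; rewrite /resolvent_term -iterSr.
by rewrite mulN1r addrCA addNr addr0.
Qed.

End ResolventSeries.

End Operators.

(** * The spectral radius *)

Section Spectrum.
Import Normc.
Local Open Scope complex_scope.
Variables (K : realType) (I : choiceType).
Implicit Types (A B : imatrix K I) (x y : I -> K[i]) (u v : I -> K) (lam mu r : K).

(** Y_j is the square root of the sum over n of (2^-n y_n(j))^2; its squared norm is at most the sum
    of the 4^-n. *)
Lemma envelope (y : nat -> I -> K) : (forall n, vnonneg (y n)) ->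
  (forall n, sqnorm (y n) <= 1)%E ->
  exists Y, [/\ vnonneg Y, (sqnorm Y < +oo)%E &
    forall n j, 2^-1 ^+ n * y n j <= Y j].
Proof.
move=> y0 y1; pose s j := esumT (fun n => ((2^-1 ^+ n * y n j) ^+ 2)%:E).
have t0 n j : (0 <= ((2^-1 ^+ n * y n j) ^+ 2)%:E)%E by rewrite lee_fin sqr_ge0.
have s0 j : (0 <= s j)%E by apply: esum_ge0.
have ssum : (esumT s <= ((1 - 4^-1)^-1)%:E)%E.
  have q01 : 0 <= (4^-1 : K) < 1 by apply/andP; split; lra.
  rewrite /s esum_swap//; apply: le_trans (geometric_esum q01).
  apply: le_esum => n _; rewrite -/(sqnorm (fun j => 2^-1 ^+ n * y n j)) sqnormZ.
  have -> : (2^-1 ^+ n) ^+ 2 = 4^-1 ^+ n :> K.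
    by rewrite exprAC; congr (_ ^+ n); rewrite expr2; field.
  by rewrite -[leRHS]mule1; apply: lee_wpmul2l; rewrite ?lee_fin ?exprn_ge0.
have sfin j : (fine (s j))%:E = s j.
  apply: (EFin_fine_le (s0 j)); apply: le_trans ssum.
  exact: ge_esum1.
exists (fun j => Num.sqrt (fine (s j))); split => [j||n j]; first exact: sqrtr_ge0.
  apply: (@le_lt_trans _ _ (esumT s)); last exact: le_lt_trans ssum (ltry _).
  by apply: le_esum => j _; rewrite sqr_sqrtr ?sfin// fine_ge0.
rewrite -[leLHS]ger0_norm; last by rewrite mulr_ge0 ?exprn_ge0 ?invr_ge0//; exact: y0.
rewrite -sqrtr_sqr ler_wsqrtr// -lee_fin sfin.
exact: (@ge_esum1 _ _ (fun n => ((2^-1 ^+ n * y n j) ^+ 2)%:E)).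
Qed.

(* Gliding hump: for non-negative matrices a single envelope dominating the
   scaled test vectors 2^-n x_n replaces the closed graph theorem. *)
Lemma defines_operator_posop A : nonneg A -> defines_operator A -> posop A.
Proof.
move=> A0 Aop; split => //; apply: contrapT => nb.
(* The rate 8^n outweighs the factor 4^-n lost by scaling both vectors by 2^-n, so the form at the
   two envelopes exceeds every 2^n. *)
have /choice[xy xyP] : forall n : nat, exists xy : (I -> K) * (I -> K),
    [/\ vnonneg xy.1, vnonneg xy.2, (sqnorm xy.1 <= 1)%E, (sqnorm xy.2 <= 1)%E &
        ((8 ^+ n)%:E < bilin A xy.1 xy.2)%E].
  move=> n; apply: contrapT => nxy; apply: nb; exists (8 ^+ n) => x y x0 y0 x1 y1.
  by rewrite leNgt; apply/negP => lt; apply: nxy; exists (x, y).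
have [X [X0 Xoo XP]] := @envelope (fun n => (xy n).1)
  (fun n => let: And5 p _ _ _ _ := xyP n in p)
  (fun n => let: And5 _ _ p _ _ := xyP n in p).
have [Y [Y0 Yoo YP]] := @envelope (fun n => (xy n).2)
  (fun n => let: And5 _ p _ _ _ := xyP n in p)
  (fun n => let: And5 _ _ _ p _ := xyP n in p).
have [AYs AY2] := Aop _ (l2_real Y0 Yoo).
(* Boundedness of A is not yet available: finiteness of the row sums comes from the hypothesis
   applied to the square-summable Y. *)
have AYE i : (ract A Y i)%:E = eact A Y i.
  have /csummableE := AYs i; rewrite /ract /eact.
  under [X in (X < _)%E -> _]eq_esum do rewrite normcM !normc_real !ger0_norm//.
  by apply: esum_fineK => j; exact: mulr_ge0.
have v0 : vnonneg (ract A Y) by exact: ract_ge0.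
have voo : (sqnorm (ract A Y) < +oo)%E.
  have := l2_lty AY2; congr (sqnorm _ < _)%E; apply/funext => i.
  rewrite /vabs /mxact (_ : (fun j => _) = (fun j => (A i j * Y j)%:C)); last first.
    by apply/funext => j; rewrite rmorphM.
  rewrite csum_real; last by move=> j; exact: mulr_ge0.
  by rewrite normc_real ger0_norm//; exact: v0.
have [a a0 Xa] := sqnormP Xoo; have [b b0 vb] := sqnormP voo.
have bilab : (bilin A X Y <= (a * b)%:E)%E.
  rewrite bilinE//; apply: le_trans (esum_CauchySchwarz X0 v0 a0 b0 Xa vb).
  by apply: le_esum => i _; rewrite -AYE.
have key n : 2 ^+ n <= a * b.
  have [x0 y0 x1 y1 big] := xyP n; rewrite -lee_fin; apply: le_trans bilab.
  have p0 : 0 <= (2^-1 : K) ^+ n by rewrite exprn_ge0.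
  apply: (@le_trans _ _ (bilin A (fun i => 2^-1 ^+ n * (xy n).1 i)
                                 (fun i => 2^-1 ^+ n * (xy n).2 i))).
    rewrite bilinZ//; apply: (@le_trans _ _ ((2^-1 ^+ n * 2^-1 ^+ n)%:E * (8 ^+ n)%:E)%E).
      rewrite -EFinM lee_fin -!exprMn.
      by rewrite (_ : 2^-1 * 2^-1 * 8 = 2 :> K)//; field.
    by apply: lee_wpmul2l; [rewrite lee_fin mulr_ge0|exact: ltW].
  apply: le_esum => i _; apply: le_esum => j _; rewrite lee_fin.
  apply: ler_pM; [| | |exact: YP].
  - by rewrite !mulr_ge0//; exact: x0.
  - by rewrite mulr_ge0//; exact: y0.
  - by rewrite ler_wpM2r//; exact: XP.
have : a * b < 2 ^+ (Num.bound (a * b)).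
  apply: lt_le_trans (archi_boundP (mulr_ge0 a0 b0)) _.
  have := expr_ge_linear (Num.bound (a * b)) (ler01 : 0 <= 1 :> K).
  by rewrite mulr1 => h; apply: le_trans h; rewrite lerDr.
by rewrite ltNge key.
Qed.

Lemma mxact_real A M v : nonneg A -> bounded_by A M -> vnonneg v ->
  mxact A (fun i => (v i)%:C) = (fun i => (ract A v i)%:C).
Proof.
move=> A0 AM v0; apply/funext => i; rewrite /mxact -csum_real; last first.
  by move=> j; exact: mulr_ge0.
by congr csum; apply/funext => j; rewrite rmorphM.
Qed.

Lemma vabs_real v : vnonneg v -> vabs (fun i => (v i)%:C) = v.
Proof. by move=> v0; apply/funext => i; rewrite /vabs normc_real ger0_norm. Qed.

(* If r is a resolvent point, the positive resolvents at the points lam > r stay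
   bounded as lam decreases to r, so growth_resolvent_shift crosses r. *)
Lemma growth_below A r : posop A -> 0 < r -> (forall lam, r < lam -> growth A lam) ->
  resolvent_set A (r%:C) -> exists2 mu, 0 < mu < r & growth A mu.
Proof.
move=> Ab r0 gr [T [Tl2 Tlin [C0 TC0]] TP].
have [A0 [MA AM]] := Ab.
pose C := Num.max C0 1; have C1 : 1 <= C by rewrite /C le_max lexx orbT.
have Cp : 0 < C by exact: lt_le_trans C1.
have TC x : l2 x -> l2norm (T x) <= C * l2norm x.
  move=> xs; apply: le_trans (TC0 x xs) _; rewrite ler_wpM2r ?sqrtr_ge0//.
  by rewrite /C le_max lexx.
(* The first bound gives eps (2 C) < 1 for the shift; the second keeps lam - eps = r - eps / 2
   positive. *)
pose eps := Num.min ((4 * C)^-1) (r / 2).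
have e0 : 0 < eps by rewrite /eps lt_min invr_gt0 mulr_gt0// divr_gt0.
have eC : eps * C <= 4^-1.
  apply: (@le_trans _ _ ((4 * C)^-1 * C)); last by rewrite invfM mulfVK ?gt_eqF.
  by rewrite ler_wpM2r ?(ltW Cp)// /eps ge_min lexx.
have er : eps <= r / 2 by rewrite /eps ge_min lexx orbT.
(* Growth at the intermediate lam', strictly between r and lam, makes the Neumann series at lam
   converge. *)
pose lam := r + eps / 2; pose lam' := r + eps / 4.
have l0 : 0 < lam by rewrite /lam; lra.
have l0' : 0 <= lam' by rewrite /lam'; lra.
have ll : lam^-1 * lam' < 1.
  by rewrite mulrC ltr_pdivrMr// mul1r /lam /lam'; lra.
have [D D0 hD] : growth A lam' by apply: gr; rewrite /lam'; lra.
have li0 : 0 <= lam^-1 by rewrite invr_ge0 ltW.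
pose N := neumann A lam^-1.
have Nb : posop N := posop_neumann Ab l0' (ltW D0) li0 ll hD.
have NE i j : N i j = mxid K (I:=I) i j + lam^-1 * mxprod A N i j.
  exact: (neumann_eq Ab l0' (ltW D0) li0 ll hD).
pose R i j := lam^-1 * N i j.
have Rb : posop R by exact: posopZ.
have ARb := posop_prod Ab Rb.
have RE i j : lam * R i j = mxid K (I:=I) i j + mxprod A R i j.
  by rewrite mxprodZr// /R mulrA divff ?gt_eqF// mul1r NE.
have [R0 [MR RM]] := Rb.
suff R2C : bounded_by R (2 * C).
  exists (lam - eps).
    by apply/andP; split; rewrite /lam; lra.
  apply: (@growth_resolvent_shift _ _ _ R _ _ (2 * C)) => //.
  - exact: ltW.
  - by rewrite mulrCA; lra.
  - by rewrite /lam; lra.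
apply: bounded_byP => // [|y y0 y1]; first by rewrite mulr_ge0// ltW.
have yoo : (sqnorm y < +oo)%E := sqnorm_lty y1.
pose v := ract R y; have v0 : vnonneg v by exact: ract_ge0.
have vE i : (v i)%:E = eact R y i by rewrite (ractE _ R0 RM).
have voo : (sqnorm v < +oo)%E by exact: sqnorm_ract_lty.
exists v; split => // [i|]; first by rewrite vE.
have vlam i : lam * v i = y i + ract A v i.
  apply: EFin_inj; rewrite EFinM vE [RHS]EFinD (ractE i A0 AM)// -eact_prod//.
  rewrite -[in RHS](@eact_id K I)//.
  rewrite /eact -esumZl ?(ltW l0)//; last by move=> j; rewrite lee_fin mulr_ge0.
  rewrite -esumD; last 2 first.
  - by move=> j _; rewrite lee_fin mulr_ge0 ?nonneg_id.
  - by move=> j _; rewrite lee_fin mulr_ge0//; case: ARb.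
  by apply: eq_esum => j _; rewrite -EFinM mulrA RE mulrDl EFinD.
pose V i := (v i)%:C; pose Y i := (y i)%:C.
have V2 : l2 V by exact: l2_real.
have Y2 : l2 Y by exact: l2_real.
pose del := eps / 2.
(* From (lam - A) v = y and lam = r + del one gets (r - A) v = y - del v, so the bound on T gives
   |v| <= C |y - del v|, with C independent of lam. *)
have shiftV : shift_op r%:C A V = (fun i => 1 * Y i + (- del)%:C * V i).
  apply/funext => i; rewrite /shift_op (mxact_real A0 AM v0) /V /Y -!rmorphM -rmorphB.
  rewrite mul1r -rmorphD/=; congr (_ %:C).
  by have := vlam i; rewrite /lam /del; lra.
have [TV _] := TP V V2.
have W2 : l2 (shift_op r%:C A V).
  rewrite shiftV (_ : (fun i => _) = (fun i => (- del)%:C * V i + Y i)); last first.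
    by apply/funext => i; rewrite mul1r addrC.
  exact: l2_lin.
have := TC _ W2; rewrite TV => VW.
set q := l2norm V in VW.
have q0 : 0 <= q by exact: sqrtr_ge0.
have Wb : l2norm (shift_op r%:C A V) ^+ 2 <= 2 + 2 * del ^+ 2 * q ^+ 2.
  rewrite -lee_fin -sqnorm_l2norm// shiftV; apply: le_trans (sqnorm_vabsD _ _ _ _) _.
  rewrite normc1 normc_real normrN expr1n mulr1 (sqnorm_l2norm V2) -/q.
  rewrite vabs_real// [leRHS]EFinD; apply: leeD.
    by rewrite -[leRHS]mule1; apply: lee_wpmul2l.
  by rewrite -EFinM lee_fin real_normK// num_real.
have qC : q ^+ 2 <= C ^+ 2 * (2 + 2 * del ^+ 2 * q ^+ 2).
  apply: (@le_trans _ _ ((C * l2norm (shift_op r%:C A V)) ^+ 2)).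
    by rewrite ler_sqr ?nnegrE// mulr_ge0 ?sqrtr_ge0// ltW.
  by rewrite exprMn ler_wpM2l// sqr_ge0.
(* This absorbs the term in q: q^2 <= 2 C^2 + q^2 / 4, whence q <= 2 C. *)
have Cd : C ^+ 2 * del ^+ 2 <= 8^-1.
  have : (eps * C) ^+ 2 <= 4^-1 ^+ 2.
    by rewrite ler_sqr ?nnegrE// mulr_ge0 ?(ltW e0) ?(ltW Cp).
  rewrite /del (_ : C ^+ 2 * (eps / 2) ^+ 2 = (eps * C) ^+ 2 / 4); last by field.
  by move=> h; lra.
rewrite -(vabs_real v0) -/V sqnorm_l2norm// lee_fin -/q.
have : C ^+ 2 * del ^+ 2 * q ^+ 2 <= 8^-1 * q ^+ 2 by rewrite ler_wpM2r// sqr_ge0.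
have := sqr_ge0 C.
rewrite (_ : C ^+ 2 * (2 + 2 * del ^+ 2 * q ^+ 2) =
  2 * C ^+ 2 + 2 * (C ^+ 2 * del ^+ 2 * q ^+ 2)) in qC; last by ring.
rewrite (_ : (2 * C) ^+ 2 = 4 * C ^+ 2); last by ring.
by move: qC; set P := C ^+ 2 * del ^+ 2 * q ^+ 2; lra.
Qed.

Lemma spectrum_le A lam z : posop A -> 0 <= lam -> growth A lam ->
  spectrum A z -> normc z <= lam.
Proof.
move=> Ab l0 g; apply: contraPT; rewrite -ltNge => lz.
by move=> /(_ (mem_resolvent_set Ab l0 g lz)).
Qed.

(** Moduli are non-negative, and [sup] is 0 by default on an empty or unbounded set. *)
Lemma spectral_radius_ge0 A : 0 <= spectral_radius A.
Proof.
rewrite /spectral_radius; have [[[_ [z zA _]] ub]|ns] := pselect (has_sup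
    [set normc z | z in spectrum A]); last by rewrite sup_out.
by apply: le_trans (normc_ge0 z) _; apply: ub_le_sup => //; exists z.
Qed.

Lemma spectral_radius_le A lam : posop A -> 0 <= lam -> growth A lam ->
  spectral_radius A <= lam.
Proof.
move=> Ab l0 g; rewrite /spectral_radius.
have [->|/set0P ne] := eqVneq [set normc z | z in spectrum A] set0.
  by rewrite sup0.
by apply: ge_sup => // _ [z zA <-]; exact: spectrum_le zA.
Qed.

Lemma growth_of_spectral_radius_lt A lam : posop A -> spectral_radius A < lam ->
  growth A lam.
Proof.
move=> Ab rl; have l0 : 0 < lam := le_lt_trans (spectral_radius_ge0 A) rl.
apply: contrapT => ng; have [M M0 AM] := posop_gt0 Ab.
have gM := growth_bounded_by Ab.1 AM.
pose G := [set mu | 0 < mu /\ growth A mu]; pose r := inf G.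
have GM : G M by [].
have lbG : lbound G lam.
  move=> mu [mu0 gmu]; rewrite leNgt; apply/negP => mul; apply: ng.
  by apply: growth_leM gmu; exact: ltW.
have lr : lam <= r by apply: lb_le_inf => //; exists M.
have r0 : 0 < r := lt_le_trans l0 lr.
have gr mu : r < mu -> growth A mu.
  move=> /(@inf_lt _ _ _ (ex_intro _ M GM))[nu [nu0 gnu] numu].
  by apply: growth_leM gnu; exact: ltW.
(* The infimum r of the positive growth rates is either a resolvent point, and then a smaller rate
   exists, or a spectral point, and then the spectral radius is at least r >= lam. *)
have [rA|rA] := pselect (resolvent_set A r%:C).
  have [mu /andP[mu0 mur] gmu] := growth_below Ab r0 gr rA.
  have : r <= mu by apply: ge_inf => //; exists lam.
  by rewrite leNgt mur.
have : r <= spectral_radius A.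
  apply: ub_le_sup; last by exists r%:C => //; rewrite normc_real gtr0_norm.
  by exists M => _ [z zA <-]; exact: spectrum_le (ltW M0) gM zA.
by rewrite leNgt (lt_le_trans rl lr).
Qed.

End Spectrum.

(** * The chain of inequalities *)

Section HadamardInequalities.
Variables (K : realType) (I : choiceType).
Implicit Types (B C : imatrix K I) (t lam : K).

(** With a single factor the condition m al >= 1 reads t >= 1. *)
Lemma hpow_geomean B t : hpow B t = geomean t (fun _ : 'I_1 => B).
Proof.
by apply/funext => i; apply/funext => j; rewrite /geomean /hadamard big_ord1.
Qed.

Lemma posop_hpow B t : 1 <= t -> posop B -> posop (hpow B t).
Proof.
move=> t1 Bb; rewrite hpow_geomean; apply: posop_geomean => //; last by rewrite mul1r.
exact: lt_le_trans t1.
Qed.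

Lemma growth_hpow B t lam : 1 <= t -> posop B -> 0 < lam -> growth B lam ->
  growth (hpow B t) (lam `^ t).
Proof.
move=> t1 Bb l0 g; have t0 : 0 < t by exact: lt_le_trans t1.
have := @growth_geomean K I 1 t (fun=> B) (fun=> lam) t0.
by rewrite mul1r big_ord1 -hpow_geomean; apply.
Qed.

Lemma mxprod_seq_hpow_le (J : Type) (F : J -> imatrix K I) (r : seq J) t i k :
  1 <= t -> (forall j, posop (F j)) ->
  mxprod_seq [seq hpow (F j) t | j <- r] i k <=
  hpow (mxprod_seq [seq F j | j <- r]) t i k.
Proof.
move=> t1 Fb; have t0 : 0 < t by exact: lt_le_trans t1.
have := @geomean_seq K I 1 t t0 _ J (fun j _ => F j) r i k (fun j _ => Fb j).
rewrite mul1r -hpow_geomean => /(_ t1); congr (mxprod_seq _ i k <= _).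
by apply: eq_map => j; rewrite hpow_geomean.
Qed.

Lemma geomean1 m (B : 'I_m -> imatrix K I) : (forall l, nonneg (B l)) ->
  geomean 1 B = hadamard B.
Proof.
move=> B0; apply/funext => i; apply/funext => j.
by apply: eq_bigr => l _; rewrite /hpow powRr1//; exact: B0.
Qed.

Lemma posop_hadamard n (B : 'I_n.+1 -> imatrix K I) : (forall l, posop (B l)) ->
  posop (hadamard B).
Proof.
move=> Bb; rewrite -geomean1; last by move=> l; case: (Bb l).
by apply: posop_geomean => //; rewrite mulr1 ler1n.
Qed.

Lemma hadamard_prod_le n (B C : 'I_n.+1 -> imatrix K I) i j :
  (forall l, posop (B l)) -> (forall l, posop (C l)) ->
  mxprod (hadamard B) (hadamard C) i j <= hadamard (fun l => mxprod (B l) (C l)) i j.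
Proof.
move=> Bb Cb; have [B0 C0] : (forall l, nonneg (B l)) /\ (forall l, nonneg (C l)).
  by split => l; [case: (Bb l)|case: (Cb l)].
rewrite -!geomean1//; last by move=> l; exact: mxprod_ge0.
by apply: geomean_prod => //; rewrite mulr1 ler1n.
Qed.

Lemma ler_powR2r (a b p : K) : 0 <= p -> 0 <= a -> a <= b -> a `^ p <= b `^ p.
Proof.
by move=> p0 a0 ab; apply: ge0_ler_powR; rewrite ?nnegrE// (le_trans a0).
Qed.

(** The spectral radius itself may fail to be a growth rate, as for a Jordan block, so comparisons
    go through all lam strictly above it. *)
Lemma le_of_forall_gt (a b : K) : (forall c, b < c -> a <= c) -> a <= b.
Proof.
move=> h; rewrite leNgt; apply/negP => ba.
by have := h ((a + b) / 2); lra.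
Qed.

(** Rotation of the index list is translation in Z/(n+1), which permits reindexing of Hadamard
    products. *)
Lemma rot_enum_ord n (l : 'I_n.+1) :
  rot l (enum 'I_n.+1) = [seq (l + j)%R | j <- enum 'I_n.+1].
Proof.
apply: (inj_map val_inj); rewrite map_rot.
rewrite [RHS](_ : _ = [seq (l + j) %% n.+1 | j <- iota 0 n.+1]%N); last first.
  by rewrite -map_comp -val_enum_ord -map_comp; apply: eq_map.
rewrite val_enum_ord; have ln := ltn_ord l.
apply: (@eq_from_nth _ 0%N); first by rewrite size_rot size_map.
move=> k; rewrite size_rot size_iota => kn.
rewrite (nth_map 0%N) ?size_iota// nth_iota// add0n.
rewrite /rot nth_cat size_drop size_iota nth_drop.
case: ltnP => kl.
  by rewrite nth_iota ?add0n ?modn_small; lia.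
rewrite nth_take; last by lia.
rewrite nth_iota ?add0n; last by lia.
have -> : (l + k = k - (n.+1 - l) + n.+1)%N by lia.
by rewrite modnDr modn_small//; lia.
Qed.

Lemma spectral_radius_le_mono B C : posop B -> posop C ->
  (forall i j, B i j <= C i j) -> spectral_radius B <= spectral_radius C.
Proof.
move=> Bb Cb BC; apply: le_of_forall_gt => lam lt.
have l0 : 0 <= lam := le_trans (spectral_radius_ge0 C) (ltW lt).
apply: spectral_radius_le => //; apply: (growth_le Bb Cb BC).
exact: growth_of_spectral_radius_lt.
Qed.

(** Hoelder with al = 1 puts the Gram matrix of the Hadamard product below the Hadamard product of
    the Gram matrices; [growth_gram] then turns a growth rate into a norm bound. *)
Lemma opnorm_hadamard_le n (A : 'I_n.+1 -> imatrix K I) : (forall k, posop (A k)) ->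
  opnorm (hadamard A) ^+ 2 <=
  spectral_radius (hadamard (fun k => mxprod (A k) (mxtr (A k)))).
Proof.
move=> Ab; have Atb k : posop (mxtr (A k)) by exact: posop_tr.
have Sb k : posop (mxprod (A k) (mxtr (A k))) by exact: posop_prod.
have [hA hS] := (posop_hadamard Ab, posop_hadamard Sb).
apply: le_of_forall_gt => lam lt.
have l0 : 0 < lam := le_lt_trans (spectral_radius_ge0 _) lt.
have g : growth (mxprod (hadamard A) (mxtr (hadamard A))) lam.
  apply: growth_le (growth_of_spectral_radius_lt hS lt) => //.
    by apply: posop_prod => //; exact: posop_tr.
  by move=> i j; exact: hadamard_prod_le Ab Atb.
have /andP[o0 ol] := opnorm_le hA.1 (growth_gram hA l0 g).
by rewrite -(sqr_sqrtr (ltW l0)) ler_sqr ?nnegrE ?sqrtr_ge0.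
Qed.

(** * Comparisons between the Hadamard product and the ordered products *)

Section Products.
Variables (n : nat) (S : 'I_n.+1 -> imatrix K I) (t : K).
Hypotheses (Sb : forall k, posop (S k)) (t1 : 1 <= t) (tn : t <= n.+1%:R).

Let t0 : 0 < t. Proof. exact: lt_le_trans t1. Qed.
Let ti0 : 0 < t^-1. Proof. by rewrite invr_gt0. Qed.
Let nt : 1 <= n.+1%:R * t^-1. Proof. by rewrite ler_pdivlMr ?mul1r. Qed.

Let Stb k : posop (hpow (S k) t). Proof. exact: posop_hpow. Qed.

Let T (k : 'I_n.+1) := mxprod_seq [seq hpow (S j) t | j <- rot k (enum 'I_n.+1)].
Let pSt := mxprod_seq [seq hpow (S j) t | j <- enum 'I_n.+1].
Let pS := mxprod_seq [seq S j | j <- enum 'I_n.+1].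
Let hT := hadamard (fun k => hpow (T k) t^-1).

Let Tb k : posop (T k). Proof. exact: posop_seq. Qed.
Let pStb : posop pSt. Proof. exact: posop_seq. Qed.
Let pSb : posop pS. Proof. exact: posop_seq. Qed.
Let hTb : posop hT. Proof. exact: posop_geomean. Qed.

(* The j-th factor of (S_1 o ... o S_m)^m is written as the Hadamard product of
   the S_(l+j), l ranging over Z/m, so that Hoelder regroups the l-th factors
   into T_l. *)
Lemma hadamard_pow_le i k : mxpow (hadamard S) n.+1 i k <= hT i k.
Proof.
(* Translation by j permutes the factors, and the exponents t and 1/t cancel. *)
have rows j : geomean t^-1 (fun l : 'I_n.+1 => hpow (S (l + j)%R) t) = hadamard S.
  apply/funext => a; apply/funext => b; rewrite /geomean /hadamard.
  rewrite [RHS](reindex_inj (addIr j)); apply: eq_bigr => l _.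
  rewrite /hpow -powRrM divff ?gt_eqF// powRr1//.
  by have [S0 _] := Sb (l + j)%R; exact: S0.
have := @geomean_seq K I n.+1 t^-1 ti0 nt _ (fun j l => hpow (S (l + j)%R) t)
  (enum 'I_n.+1) i k (fun j l => Stb _).
rewrite (eq_map rows) mxprod_seq_const size_enum_ord.
congr (_ <= hadamard _ _ _); apply/funext => l; congr hpow.
rewrite /T rot_enum_ord; congr mxprod_seq.
exact: (map_comp (fun j => hpow (S j) t) (fun j => (l + j)%R)).
Qed.

(** A rate lam for the right-hand matrix is one for the (n+1)-st power of the Hadamard product, and
    [growth_root] extracts the root. *)
Lemma spectral_radius_hadamard_le :
  spectral_radius (hadamard S) <= spectral_radius hT `^ n.+1%:R^-1.
Proof.
have hSb := posop_hadamard Sb.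
have r0 := spectral_radius_ge0 (hadamard S).
have -> : spectral_radius (hadamard S) =
    (spectral_radius (hadamard S) ^+ n.+1) `^ n.+1%:R^-1.
  by rewrite -powR_mulrn// -powRrM divff ?pnatr_eq0// powRr1.
have ni0 : 0 <= n.+1%:R^-1 :> K by rewrite invr_ge0.
apply: ler_powR2r; [exact: ni0|exact: exprn_ge0|].
apply: le_of_forall_gt => lam lt.
have l0 : 0 < lam := le_lt_trans (spectral_radius_ge0 _) lt.
have lE : (lam `^ n.+1%:R^-1) ^+ n.+1 = lam.
  by rewrite -powR_mulrn ?powR_ge0// -powRrM mulVf ?pnatr_eq0// powRr1 ?ltW.
have g : growth (hadamard S) (lam `^ n.+1%:R^-1).
  apply: (@growth_root _ _ _ _ n.+1) => //; first exact: powR_gt0.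
  rewrite lE; apply: growth_le (growth_of_spectral_radius_lt hTb lt) => //.
    exact: posop_pow.
  exact: hadamard_pow_le.
rewrite -lE; apply: lerXn2r; rewrite ?nnegrE ?powR_ge0//.
by apply: spectral_radius_le => //; exact: powR_ge0.
Qed.

(** Cutting the index list at k writes the two products as P Q and Q P. *)
Lemma growth_rot k lam : 0 < lam -> growth pSt lam -> growth (T k) lam.
Proof.
move=> l0; pose P (r : seq 'I_n.+1) := mxprod_seq [seq hpow (S j) t | j <- r].
have Pb r : posop (P r) by exact: posop_seq.
have -> : pSt = mxprod (P (take k (enum 'I_n.+1))) (P (drop k (enum 'I_n.+1))).
  by rewrite /P -(mxprod_seq_cat _ _ Stb) cat_take_drop.
have -> : T k = mxprod (P (drop k (enum 'I_n.+1))) (P (take k (enum 'I_n.+1))).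
  by rewrite /P -(mxprod_seq_cat _ _ Stb).
exact: growth_cycle (Pb _) (Pb _) l0.
Qed.

Lemma spectral_radius_geomean_le :
  spectral_radius hT `^ n.+1%:R^-1 <= spectral_radius pSt `^ t^-1.
Proof.
(* Writing the left side as a t-th power under 1/t leaves a bare spectral radius on the right, to be
   approached from above by lam. *)
have -> : spectral_radius hT `^ n.+1%:R^-1 =
    ((spectral_radius hT `^ n.+1%:R^-1) `^ t) `^ t^-1.
  by rewrite -[RHS]powRrM divff ?gt_eqF// powRr1// powR_ge0.
apply: ler_powR2r; [exact: ltW|exact: powR_ge0|].
apply: le_of_forall_gt => lam lt.
have l0 : 0 < lam := le_lt_trans (spectral_radius_ge0 _) lt.
have g := growth_of_spectral_radius_lt pStb lt.
have := growth_geomean ti0 nt Tb (fun=> l0) (fun k => growth_rot k l0 g).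
rewrite prodr_const card_ord => gT.
have := spectral_radius_le hTb (exprn_ge0 _ (powR_ge0 _ _)) gT => h.
have lE : lam = (((lam `^ t^-1) ^+ n.+1) `^ n.+1%:R^-1) `^ t.
  rewrite -(powR_mulrn _ (powR_ge0 _ _)) -!powRrM.
  have : n.+1%:R != 0 :> K by rewrite pnatr_eq0.
  move: (n.+1%:R) => N N0.
  rewrite [X in lam `^ X](_ : _ = 1) ?powRr1 ?ltW//; field.
  by rewrite N0 gt_eqF.
have ni0 : 0 <= n.+1%:R^-1 :> K by rewrite invr_ge0.
rewrite [leRHS]lE; apply: ler_powR2r; [exact: ltW|exact: powR_ge0|].
by apply: ler_powR2r h => //; exact: spectral_radius_ge0.
Qed.

Lemma spectral_radius_prod_hpow_le :
  spectral_radius pSt `^ t^-1 <= spectral_radius (hpow pS t) `^ t^-1.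
Proof.
apply: ler_powR2r; [exact: ltW|exact: spectral_radius_ge0|].
apply: spectral_radius_le_mono => //; first exact: posop_hpow.
by move=> i k; exact: mxprod_seq_hpow_le.
Qed.

Lemma spectral_radius_hpow_le :
  spectral_radius (hpow pS t) `^ t^-1 <= spectral_radius pS.
Proof.
apply: le_of_forall_gt => lam lt.
have l0 : 0 < lam := le_lt_trans (spectral_radius_ge0 _) lt.
have g := growth_hpow t1 pSb l0 (growth_of_spectral_radius_lt pSb lt).
have h := spectral_radius_le (posop_hpow t1 pSb) (powR_ge0 _ _) g.
have lE : lam = (lam `^ t) `^ t^-1.
  by rewrite -powRrM divff ?gt_eqF// powRr1// ltW.
rewrite [leRHS]lE; apply: ler_powR2r h; first exact: ltW.
exact: spectral_radius_ge0.
Qed.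

End Products.

End HadamardInequalities.

Theorem corollary3p5 (K : realType) (D : set nat) (hD : index_range D)
    (m : nat) (A : 'I_m -> imatrix K D)
    (A_ge0 : forall k, nonneg (A k))
    (A_op : forall k, defines_operator (A k))
    (t : K) (ht : 1 <= t <= m%:R) :
  let S := fun k : 'I_m => mxprod (A k) (mxtr (A k)) in
  let T := fun k : 'I_m =>
    mxprod_seq [seq hpow (S j) t | j <- rot k (enum 'I_m)] in
  let hA := hadamard A in
  let hS := hadamard S in
  let hT := hadamard (fun k => hpow (T k) t^-1) in
  let pSt := mxprod_seq [seq hpow (S j) t | j <- enum 'I_m] in
  let pS := mxprod_seq [seq S j | j <- enum 'I_m] in
  [/\ defines_operator hA, defines_operator hS & defines_operator hT] /\
  [/\ defines_operator pSt, defines_operator (hpow pS t)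
    & defines_operator pS] /\
  [/\ opnorm hA ^+ 2 <= spectral_radius hS,
      spectral_radius hS <= spectral_radius hT `^ m%:R^-1,
      spectral_radius hT `^ m%:R^-1 <= spectral_radius pSt `^ t^-1,
      spectral_radius pSt `^ t^-1 <= spectral_radius (hpow pS t) `^ t^-1
    & spectral_radius (hpow pS t) `^ t^-1 <= spectral_radius pS].
Proof.
move: ht; case: m A A_ge0 A_op => [|n] A A_ge0 A_op /andP[t1 tn].
  (* For m = 0 no t satisfies 1 <= t <= m. *)
  by have := le_trans t1 tn; rewrite ler10.
(* The gliding hump enters here: pointwise definedness is exchanged for boundedness once, and
   everything after works with [posop]. *)
have Ab k : posop (A k) by exact: defines_operator_posop.
move=> S T hA hS hT pSt pS.
have Sb k : posop (S k) by apply: posop_prod => //; exact: posop_tr.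
have t0 : 0 < t by exact: lt_le_trans t1.
have Stb k : posop (hpow (S k) t) by exact: posop_hpow.
have pSb : posop pS by exact: posop_seq.
split; last split; split.
- by apply: posop_defines_operator; exact: posop_hadamard.
- by apply: posop_defines_operator; exact: posop_hadamard.
- apply: posop_defines_operator; apply: posop_geomean => [||k].
  + by rewrite invr_gt0.
  + by rewrite ler_pdivlMr ?mul1r.
  + exact: posop_seq.
- by apply: posop_defines_operator; exact: posop_seq.
- by apply: posop_defines_operator; exact: posop_hpow.
- exact: posop_defines_operator.
- exact: opnorm_hadamard_le.
- exact: spectral_radius_hadamard_le.
- exact: spectral_radius_geomean_le.
- exact: spectral_radius_prod_hpow_le.
- exact: spectral_radius_hpow_le.
Qed.
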